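(* Let $G$ be a finitely presented group with an element of infinite order. If every Cayley graph $X$ of $G$ admits a sequence $(Y_n)_{n}$ of finite graphs such that $Y_n$ is $n$-locally $X$ for every $n$, then $G$ is residually finite.
   Context: A ''graph'' means a connected, locally finite graph without loops or multiple edges, equipped with the geodesic metric giving each edge length $1$; ''$x\in X$'' means that $x$ is a vertex of $X$; balls are closed balls. Given a finitely generated group $G$ and a finite symmetric generating set $S$, the Cayley graph $(G,S)$ is the graph with vertex set $G$ and distance $d(g,h)=|g^{-1}h|_S$ (word length). Given a graph $X$ and $R>0$, a graph $Y$ is $R$-locally $X$ if for every vertex $y\in Y$ there exists $x\in X$ such that the balls $B_X(x,R)$ and $B_Y(y,R)$, equipped with their intrinsic geodesic metrics, are isometric. *)

(* Defs.v *)
From mathcomp Require Import all_boot all_order all_algebra all_fingroup.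
From mathcomp Require Import boolp classical_sets functions cardinality reals.
From mathcomp Require Import numfun.
From Stdlib Require Import Relation_Operators.

Set Implicit Arguments.
Unset Strict Implicit.
Unset Printing Implicit Defensive.

Import Order.TTheory GRing.Theory Num.Theory.
Local Open Scope classical_set_scope.
Local Open Scope ring_scope.

(* Connected graphs are nonempty by convention. *)
Record graph := Graph {
  vert :> Type;
  adj : vert -> vert -> Prop;
  adj_sym : forall x y, adj x y -> adj y x;
  adj_irrefl : forall x, ~ adj x x;
  vert_inhabited : inhabited vert;
  adj_connected : forall x y, clos_refl_trans vert adj x y;
  adj_locally_finite : forall x, finite_set [set y | adj x y] }.

Definition finite_graph (X : graph) : Prop := finite_set [set: X].

(* The metric realization of a graph, in barycentric coordinates: a point is a
   function on vertices, [vpt x] is the vertex [x], and [ept u v t] is the point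
   at distance [t] from [u] on the edge [u, v]; thus
   [ept u v t = ept v u (1 - t)]. *)
Section Realization.
Variables (R : realType) (X : graph).

Definition vpt (x : X) : X -> R := \1_[set x].

Definition ept (u v : X) (t : R) : X -> R :=
  fun w => (1 - t) * vpt u w + t * vpt v w.

Definition realization : set (X -> R) :=
  [set p | (exists x, p = vpt x) \/
           exists u v t, [/\ adj u v, 0 <= t <= 1 & p = ept u v t]].

(* [pl_path A p q l]: a piecewise linear path of length [l] from [p] to [q]
   whose image is contained in [A]; each piece is an affine path from
   [ept u v s] to [ept u v t] in an edge [u, v]. *)
Inductive pl_path (A : set (X -> R)) : (X -> R) -> (X -> R) -> R -> Prop :=
| pl_nil p : A p -> pl_path A p p 0
| pl_cons u v s t q l :
    adj u v -> 0 <= s <= 1 -> 0 <= t <= 1 ->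
    (forall a, 0 <= a <= 1 -> A (ept u v (s + a * (t - s)))) ->
    pl_path A (ept u v t) q l ->
    pl_path A (ept u v s) q (`|t - s| + l).

(* For [A = realization] this is the geodesic metric of the graph; for a
   path-connected [A] it is the intrinsic geodesic metric of [A]. *)
Definition geod_dist (A : set (X -> R)) (p q : X -> R) : R :=
  inf [set l | pl_path A p q l].

Definition cball (x : X) (r : R) : set (X -> R) :=
  [set p | realization p /\ geod_dist realization (vpt x) p <= r].

End Realization.

Definition isometric (R : realType) (T U : Type)
    (A : set T) (dA : T -> T -> R) (B : set U) (dB : U -> U -> R) : Prop :=
  exists2 f : T -> U, set_bij A B f &
    forall p q, A p -> A q -> dB (f p) (f q) = dA p q.

Definition is_locally (R : realType) (r : R) (X Y : graph) : Prop :=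
  forall y : Y, exists x : X,
    isometric (cball x r) (geod_dist (cball x r))
              (cball y r) (geod_dist (cball y r)).

Section Groups.
Local Open Scope group_scope.

Definition word_over (G : groupType) (S : seq G) (g : G) (w : seq G) : Prop :=
  {subset w <= S} /\ g = \prod_(s <- w) s.

(* Finite subsets of [G] are given by lists. *)
Definition sym_generating (G : groupType) (S : seq G) : Prop :=
  (forall s, s \in S -> s^-1 \in S) /\ (forall g, exists w, word_over S g w).

Definition is_word_length (G : groupType) (S : seq G) (g : G) (n : nat) : Prop :=
  (exists2 w, word_over S g w & size w = n) /\
  (forall w, word_over S g w -> (n <= size w)%N).

Definition cayley_adj (G : groupType) (S : seq G) (g h : G) : Prop :=
  is_word_length S (g^-1 * h) 1.

Lemma cayley_adjP (G : groupType) (S : seq G) (g h : G) :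
  cayley_adj S g h <-> g^-1 * h \in S /\ g != h.
Proof.
split=> [[[w [wS wE]] /eqP]|[gS ngh]].
  case: w wS wE => [|s [|? ?]] //= wS; rewrite big_seq1 => wE _ min.
  split; first by rewrite wE; apply: wS; rewrite mem_head.
  apply/eqP => gh; have := min [::]; rewrite gh mulVg => absurd.
  suff: word_over S (1 : G) [::] by move/absurd.
  by split=> //; rewrite big_nil.
split.
  exists [:: g^-1 * h] => //; split; last by rewrite big_seq1.
  by move=> s; rewrite inE => /eqP ->.
case=> // -[_]; rewrite big_nil => /(congr1 (mulg g)); rewrite mulKVg mulg1.
by move=> hg; rewrite hg eqxx in ngh.
Qed.

Section Cayley.
Variables (G : groupType) (S : seq G) (HS : sym_generating S).

Lemma cayley_sym (g h : G) : cayley_adj S g h -> cayley_adj S h g.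
Proof.
move=> /cayley_adjP[gS ngh]; apply/cayley_adjP; rewrite eq_sym; split=> //.
by have := HS.1 _ gS; rewrite invgM invgK.
Qed.

Lemma cayley_irrefl (g : G) : ~ cayley_adj S g g.
Proof. by move=> /cayley_adjP[_]; rewrite eqxx. Qed.

Lemma cayley_connected (g h : G) : clos_refl_trans G (cayley_adj S) g h.
Proof.
have [w [wS wE]] := HS.2 (g^-1 * h).
have {wE} -> : h = g * \prod_(s <- w) s by rewrite -wE mulKVg.
elim: w g wS => [|s w IHw] g wS; first by rewrite big_nil mulg1; apply: rt_refl.
rewrite big_cons mulgA; apply: rt_trans (IHw (g * s) _); last first.
  by move=> x xw; apply: wS; rewrite inE xw orbT.
have [->|ngs] := eqVneq (g * s) g; first exact: rt_refl.
apply: rt_step; apply/cayley_adjP; rewrite mulKg eq_sym; split=> //.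
by apply: wS; rewrite mem_head.
Qed.

Lemma cayley_locally_finite (g : G) : finite_set [set h | cayley_adj S g h].
Proof.
apply: (@sub_finite_set _ _ [set` [seq g * s | s <- S]]); last first.
  exact: finite_seq.
move=> h /= /cayley_adjP[hS _].
by apply/mapP; exists (g^-1 * h); rewrite ?mulKVg.
Qed.

Definition cayley : graph :=
  Graph cayley_sym cayley_irrefl (inhabits 1) cayley_connected
        cayley_locally_finite.

End Cayley.

(* Group presentations: the letter [(i, false)] is the generator [x_i] and
   [(i, true)] is its inverse. *)
Definition word (n : nat) := seq ('I_n * bool).

Definition eval_letter (G : groupType) (n : nat) (x : 'I_n -> G)
    (a : 'I_n * bool) : G :=
  if a.2 then (x a.1)^-1 else x a.1.

Definition eval_word (G : groupType) (n : nat) (x : 'I_n -> G) (w : word n) : G :=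
  \prod_(a <- w) eval_letter x a.

(* Equality of words in the group <x_0, ..., x_(n-1) | rels>. *)
Inductive pres_eq (n : nat) (rels : seq (word n)) : word n -> word n -> Prop :=
| pres_refl w : pres_eq rels w w
| pres_sym w1 w2 : pres_eq rels w1 w2 -> pres_eq rels w2 w1
| pres_trans w1 w2 w3 :
    pres_eq rels w1 w2 -> pres_eq rels w2 w3 -> pres_eq rels w1 w3
| pres_cancel u i b v :
    pres_eq rels (u ++ (i, b) :: (i, ~~ b) :: v) (u ++ v)
| pres_rel u r v : r \in rels -> pres_eq rels (u ++ r ++ v) (u ++ v).

Definition finitely_presented (G : groupType) : Prop :=
  exists (n : nat) (x : 'I_n -> G) (rels : seq (word n)),
    (forall g, exists w, eval_word x w = g) /\
    (forall w1 w2, eval_word x w1 = eval_word x w2 <-> pres_eq rels w1 w2).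

Definition infinite_order (G : groupType) (g : G) : Prop :=
  forall n, (0 < n)%N -> g ^+ n != 1.

Definition residually_finite (G : groupType) : Prop :=
  forall g : G, g != 1 ->
    exists (H : finGroupType) (phi : {multiplicative G -> H}), phi g != 1.

End Groups.

(* Main.v *)
(** Choose the generating set [S] so that the numbers of triangles on the edges of
    its Cayley graph [X] determine, up to inversion, the labels of all edges
    labelled by words of length at most three in a symmetric generating set [A]
    containing an element [a] of infinite order: pairs [a^k], [a^-k s] of new
    generators with generic [k] add triangles on the edges labelled [s] and on
    almost no others.  A map that fixes [A] and preserves these labels up to
    inversion fixes all products of two elements of [A], because [a^4 <> 1].

    If a finite graph [Y] is [n]-locally [X] with [n] large, call frame the
    restriction to [A] of an isomorphism [phi] from a ball of [X] of a fixed large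
    radius onto a ball of [Y].  By the rigidity above, [phi |-> phi (g _)] is well
    defined on frames for every [g] in [A], so the generators of [G] permute the
    finite set of frames.  When [n] is large compared with the lengths of the
    relators and of a given element of [G], the relators act trivially, and a
    nontrivial element acts nontrivially since the charts are injective: no
    covering theory is needed. *)

Require Import Defs.
From mathcomp Require Import all_boot all_order all_algebra all_fingroup reals.
From HB Require Import structures.
From mathcomp Require Import boolp classical_sets functions cardinality numfun.
From mathcomp Require Import lra.
Local Open Scope ring_scope.

Set Implicit Arguments.
Unset Strict Implicit.
Unset Printing Implicit Defensive.

Import Order.TTheory GRing.Theory Num.Theory.

(** * Combinatorial balls and paths in the realization *)

Section Reach.
Variable X : graph.
Implicit Types x y z : X.

Fixpoint reach (k : nat) (x y : X) : Prop :=
  if k is k'.+1 then reach k' x y \/ exists2 z, reach k' x z & adj z y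
  else x = y.

Lemma adj_neq x y : adj x y -> x <> y.
Proof. by move=> + exy; rewrite exy => /adj_irrefl. Qed.

Lemma reach_refl k x : reach k x x.
Proof. by elim: k => //= k IHk; left. Qed.

Lemma reach_le k l x y : (k <= l)%N -> reach k x y -> reach l x y.
Proof.
elim: l => [|l IHl]; first by rewrite leqn0 => /eqP ->.
by rewrite leq_eqVlt => /predU1P[->//|/IHl kl /kl] /=; left.
Qed.

Lemma reach_adj k x y z : reach k x y -> adj y z -> reach k.+1 x z.
Proof. by move=> xy yz; right; exists y. Qed.

Lemma reach1 x y : reach 1 x y <-> x = y \/ adj x y.
Proof.
split=> [[->|[z -> zy]]|[->|xy]]; [by left|by right|exact: reach_refl|].
exact: (@reach_adj 0 x x).
Qed.

Lemma reachS_adj k x y : reach k.+1 x y ->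
  x = y \/ exists2 z, reach k x z & adj z y.
Proof.
elim: k => [//|k IHk] [/IHk[->|[z xz zy]]|]; [by left| |by right].
by right; exists z => //; left.
Qed.

Lemma reach_trans k l x y z : reach k x y -> reach l y z -> reach (k + l) x z.
Proof.
move=> xy; elim: l z => [z <-|l IHl z]; first by rewrite addn0.
rewrite addnS => -[/IHl|[t /IHl xt tz]]; first by left.
exact: reach_adj tz.
Qed.

Lemma reach_ex x y : exists k, reach k x y.
Proof.
elim: (adj_connected x y) => {x y} [x y xy|x|x y z _ [k xy] _ [l yz]].
- by exists 1; apply/reach1; right.
- by exists 0.
- by exists (k + l)%N; apply: reach_trans yz.
Qed.

End Reach.

Section Realization.
Variables (R : realType) (X : graph).
Implicit Types (x y u v w z : X) (s t l : R) (p q : X -> R).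

Lemma vptE u w : vpt R u w = `[<w = u>]%:R.
Proof.
by rewrite /vpt indicE.
Qed.

Lemma vpt_id u : vpt R u u = 1.
Proof. by rewrite vptE asboolT. Qed.

Lemma vpt_neq u w : w <> u -> vpt R u w = 0.
Proof. by move=> wu; rewrite vptE asboolF. Qed.

Lemma vpt_inj : injective (@vpt R X).
Proof.
move=> u v /(congr1 (@^~ u)); rewrite vpt_id.
by have [//|uv] := pselect (u = v); rewrite vpt_neq // => /eqP; rewrite oner_eq0.
Qed.

Lemma ept0 u v : ept u v (0 : R) = vpt R u.
Proof. by apply/funext => w; rewrite /ept subr0 mul1r mul0r addr0. Qed.

Lemma ept1 u v : ept u v (1 : R) = vpt R v.
Proof. by apply/funext => w; rewrite /ept subrr mul1r mul0r add0r. Qed.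

Lemma ept_rev u v t : ept u v t = ept v u (1 - t).
Proof. by apply/funext => w; rewrite /ept; lra. Qed.

Lemma eptl u v t : u <> v -> ept u v t u = 1 - t.
Proof. by move=> uv; rewrite /ept vpt_id vpt_neq // mulr1 mulr0 addr0. Qed.

Lemma eptr u v t : u <> v -> ept u v t v = t.
Proof.
by move=> uv; rewrite /ept vpt_id vpt_neq ?mulr1 ?mulr0 ?add0r // => /esym.
Qed.

Lemma eptN u v t w : w <> u -> w <> v -> ept u v t w = 0.
Proof. by move=> wu wv; rewrite /ept !vpt_neq // !mulr0 addr0. Qed.

Lemma ept_vpt u v t z : u <> v -> ept u v t = vpt R z ->
  (u = z /\ t = 0) \/ (v = z /\ t = 1).
Proof.
move=> uv e; have [uz|uz] := pselect (u = z).
  left; split=> //; move: (congr1 (@^~ u) e); rewrite eptl // uz vpt_id; clear; lra.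
have [vz|vz] := pselect (v = z).
  by right; split=> //; move: (congr1 (@^~ v) e); rewrite eptr // vz vpt_id.
move: (congr1 (@^~ z) e).
by rewrite eptN 1?eq_sym // ?vpt_id => [/eqP|/esym//|/esym//]; rewrite eq_sym oner_eq0.
Qed.

(** The support of an interior point is the pair of ends of its edge, and the coordinates there give
    the parameter up to orientation. *)
Lemma ept_inj u v s u' v' s' : u <> v -> u' <> v' -> 0 < s < 1 ->
  ept u v s = ept u' v' s' ->
  [/\ u = u', v = v' & s = s'] \/ [/\ u = v', v = u' & s' = 1 - s].
Proof.
move=> uv uv' s01 e.
have uin : u = u' \/ u = v'.
  have [|uu'] := pselect (u = u'); first by left.
  have [|uv1] := pselect (u = v'); first by right.
  move: (congr1 (@^~ u) e) => /=; rewrite eptl // eptN // => s1; exfalso; clear -s01 s1; lra.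
have vin : v = u' \/ v = v'.
  have [|vu'] := pselect (v = u'); first by left.
  have [|vv1] := pselect (v = v'); first by right.
  move: (congr1 (@^~ v) e); rewrite eptr // eptN // => s1; exfalso; clear -s01 s1; lra.
case: uin vin => uE [vE|vE]; try by case: uv; rewrite uE vE.
  by left; move: (congr1 (@^~ v) e); rewrite eptr // vE eptr.
right; split=> //; move: (congr1 (@^~ v) e); rewrite eptr // vE eptl //; clear; lra.
Qed.

Variable A : set (X -> R).

Lemma pl_path_ge0 p q l : pl_path A p q l -> 0 <= l.
Proof.
elim=> {p q l} // u v s t q l _ _ _ _ _ l0.
by rewrite addr_ge0 // normr_ge0.
Qed.

Lemma pl_path_trans p q q' l l' :
  pl_path A p q l -> pl_path A q q' l' -> pl_path A p q' (l + l').
Proof.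
elim=> {p q l} [p _|u v s t q l uv s01 t01 st _ IH /IH qq'].
  by rewrite add0r.
by rewrite -addrA; apply: pl_cons.
Qed.

Lemma pl_path_seg u v s t : adj u v -> 0 <= s <= 1 -> 0 <= t <= 1 ->
  (forall r, Num.min s t <= r <= Num.max s t -> A (ept u v r)) ->
  pl_path A (ept u v s) (ept u v t) `|t - s|.
Proof.
move=> uv s01 t01 Ast; rewrite -[`|_|]addr0; apply: pl_cons => //; last first.
  by apply/pl_nil/Ast; rewrite ge_min le_max !lexx !orbT.
move=> a /andP[a0 a1]; apply: Ast; rewrite ge_min le_max.
have [st|ts] := lerP s t.
  by apply/andP; split; apply/orP; [left|right]; nra.
by apply/andP; split; apply/orP; [right|left]; nra.
Qed.

Lemma pl_path_sym p q l : pl_path A p q l -> pl_path A q p l.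
Proof.
elim=> {p q l} [p Ap|u v s t q l uv s01 t01 st _ IH]; first exact: pl_nil.
rewrite addrC; apply: (pl_path_trans IH); rewrite distrC -[`|_|]addr0.
apply: pl_cons => //; last by apply: pl_nil; have := st 0; rewrite mul0r addr0 lexx ler01; apply.
move=> a /andP[a0 a1]; have := st (1 - a).
have -> : s + (1 - a) * (t - s) = t + a * (s - t) by lra.
by apply; lra.
Qed.

(** A tool for lower bounds on distances: the increments of [F] add up along the pieces of a
    path. *)
Lemma pl_path_lip (F : (X -> R) -> R) :
  (forall u v s t, adj u v -> 0 <= s <= 1 -> 0 <= t <= 1 ->
     `|F (ept u v s) - F (ept u v t)| <= `|t - s|) ->
  forall p q l, pl_path A p q l -> `|F p - F q| <= l.
Proof.
move=> Flip p q l; elim=> {p q l} [p _|u v s t q l uv s01 t01 _ _ IH].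
  by rewrite subrr normr0.
rewrite -(subrKA (F (ept u v t))); apply: le_trans (ler_normD _ _) _.
by rewrite lerD // Flip.
Qed.

Lemma geod_dist_le p q l : pl_path A p q l -> geod_dist A p q <= l.
Proof.
by move=> pq; apply: ge_inf => //; exists 0 => r /pl_path_ge0.
Qed.

(** The path of length [l0] certifies that the infimum is taken over a nonempty set, so that it is
    not a default value. *)
Lemma geod_dist_lt p q l l0 : pl_path A p q l0 -> geod_dist A p q < l ->
  exists2 l', pl_path A p q l' & l' < l.
Proof.
by move=> pq /inf_lt; case=> [|l' /= pq' l'l]; [exists l0|exists l'].
Qed.

Lemma geod_dist_ge p q l l0 : pl_path A p q l0 ->
  (forall l', pl_path A p q l' -> l <= l') -> l <= geod_dist A p q.
Proof. by move=> pq h; apply: lb_le_inf; [exists l0|move=> ? /h]. Qed.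

End Realization.

(** * Metric balls *)

Section Ball.
Variables (R : realType) (X : graph) (x : X).
Implicit Types (u v w z : X) (s t l : R) (p q : X -> R).

Let near p l := exists k u, reach k x u /\
  ((p = vpt R u /\ k%:R <= l) \/
   exists v t, [/\ adj u v, 0 < t < 1, p = ept u v t & k%:R + t <= l]).

Let near_ept k u v t l :
  reach k x u -> adj u v -> 0 <= t <= 1 -> k%:R + t <= l -> near (ept u v t) l.
Proof.
move=> xu uv /andP[]; rewrite le_eqVlt => /predU1P[<- _|t0].
  by rewrite addr0 => kl; exists k, u; split=> //; left; rewrite ept0.
rewrite le_eqVlt => /predU1P[->|t1] kl; last first.
  by exists k, u; split=> //; right; exists v, t; rewrite t0.
exists k.+1, v; split; first exact: reach_adj uv.
by left; rewrite ept1 -natr1.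
Qed.

(** Induction on the path, which ends at [x]. A piece stays in one edge, so its start can be reached
    through the same end of that edge as its finish, the parameter changing by at most the length of
    the piece. *)
Lemma path_reach (A : set (X -> R)) p l : pl_path A p (vpt R x) l ->
  exists k u, reach k x u /\
  ((p = vpt R u /\ k%:R <= l) \/
   exists v t, [/\ adj u v, 0 < t < 1, p = ept u v t & k%:R + t <= l]).
Proof.
move eq: (vpt R x) => q pq; elim: pq eq => {p q l} [p _ <-|u v s t q l uv s01 t01 _ _ IH].
  by exists 0, x; split=> //; left.
move=> /IH[k [u1 [xu1 [[/(ept_vpt (adj_neq uv)) e kl]|]]]] {IH}.
  have h1 := ler_norm (t - s); have h2 := ler_norm (s - t).
  rewrite distrC in h2; case: e => -[e t0]; move: xu1 h1 h2; rewrite -e t0.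
    by move=> xu h1 h2; apply: near_ept xu uv s01 _; lra.
  rewrite (ept_rev u v s) => xv h1 h2; apply: near_ept xv (adj_sym uv) _ _.
    by lra.
  by lra.
move=> [v1 [t1 [uv1 t101 e kl]]].
have h1 := ler_norm (t - s); have h2 := ler_norm (s - t).
rewrite distrC in h2.
case: (ept_inj (adj_neq uv1) (adj_neq uv) t101 (esym e)) => -[eu ev et].
  move: xu1; rewrite eu => xu; apply: near_ept xu uv s01 _.
  by lra.
move: xu1; rewrite eu (ept_rev u v s) => xv; apply: near_ept xv (adj_sym uv) _ _.
  by lra.
by lra.
Qed.

Lemma path_vpt_reach (A : set (X -> R)) u l (k : nat) :
  pl_path A (vpt R u) (vpt R x) l -> l < k.+1%:R -> reach k x u.
Proof.
move=> /path_reach[k' [u' [xu' [[/vpt_inj -> k'l]|[v [t [uv t01 e _]]]]]]] lk.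
  by apply: reach_le xu'; rewrite -ltnS -(ltr_nat R); apply: le_lt_trans lk.
case: (ept_vpt (adj_neq uv) (esym e)) => -[_ t0]; exfalso; lra.
Qed.

(** The point lies [t] or [1 - t] beyond the end through which it is reached, which leaves less than
    [m + 1] for that end. The slack [min t (1 - t)] makes room for a path slightly longer than a
    distance of at most [m + 1]. *)
Lemma path_ept_reach (A : set (X -> R)) u v t l (m : nat) : adj u v -> 0 < t < 1 ->
  pl_path A (ept u v t) (vpt R x) l -> l < m.+1%:R + Num.min t (1 - t) ->
  reach m x u \/ reach m x v.
Proof.
move=> uv t01 /path_reach[k [u' [xu' H]]].
case: H => [[e _]|[v' [t' [uv' t'01 e kl]]] lm].
  by case: (ept_vpt (adj_neq uv) e) => -[_ t0]; exfalso; lra.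
have mt : Num.min t (1 - t) <= t by rewrite ge_min lexx.
have mt' : Num.min t (1 - t) <= 1 - t by rewrite ge_min lexx orbT.
have km : (k <= m)%N -> reach m x u'  by move/reach_le; apply.
case: (ept_inj (adj_neq uv) (adj_neq uv') t01 e) => -[eu ev et].
  left; rewrite eu; apply: km; rewrite -ltnS -(ltr_nat R).
  by lra.
right; rewrite ev; apply: km; rewrite -ltnS -(ltr_nat R).
by lra.
Qed.

Lemma reach_path (A : set (X -> R)) k u : A (vpt R x) ->
  (forall i u v t, (i < k)%N -> reach i x u -> adj u v -> 0 <= t <= 1 ->
     A (ept u v t)) ->
  reach k x u -> exists2 l, pl_path A (vpt R x) (vpt R u) l & l <= k%:R.
Proof.
move=> Ax; elim: k u => [u _ <-|k IHk u Ak]; first by exists 0; [exact: pl_nil|].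
have Ak' i w v t : (i < k)%N -> reach i x w -> adj w v -> 0 <= t <= 1 ->
  A (ept w v t) by move=> ik; apply: Ak; rewrite ltnS ltnW.
move=> [/(IHk _ Ak')[l xl lk]|[z xz zu]].
  by exists l => //; rewrite -natr1; lra.
have [l xl lk] := IHk _ Ak' xz; exists (l + `|1 - 0|).
  apply: pl_path_trans xl _; rewrite -(ept0 R z u) -(ept1 R z u).
  apply: pl_path_seg => //; rewrite ?lexx ?ler01 // => r; rewrite min_l ?max_r ?ler01 //.
  exact: (Ak k).
by rewrite subr0 normr1 -natr1; lra.
Qed.

Lemma realization_path (p : X -> R) : realization p ->
  exists l, pl_path (@realization R X) (vpt R x) p l.
Proof.
have rx u : @realization R X (vpt R u) by left; exists u.
have re u v t : adj u v -> 0 <= t <= 1 -> @realization R X (ept u v t).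
  by move=> uv t01; right; exists u, v, t.
have vp u : exists l, pl_path (@realization R X) (vpt R x) (vpt R u) l.
  have [k xu] := reach_ex x u.
  have [i w v t _ _|l xl _] := reach_path (rx x) _ xu; first exact: re.
  by exists l.
case=> [[u ->]//|[u [v [t [uv t01 ->]]]]].
have [l xl] := vp u; exists (l + `|t - 0|); apply: pl_path_trans xl _.
rewrite -(ept0 R u v); apply: pl_path_seg => //; first by rewrite lexx ler01.
move=> r; rewrite min_l ?max_r; try by case/andP: t01.
by move=> /andP[r0 rt]; apply: re => //; lra.
Qed.

Lemma geod_dist_sym (A : set (X -> R)) p q :
  geod_dist A p q = geod_dist A q p.
Proof.
by rewrite /geod_dist; congr inf; apply/seteqP; split=> l /=; exact: pl_path_sym.
Qed.

Variable m : nat.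
Notation B := (cball x (m.+1%:R : R)).

Lemma in_ball k u v t : (k <= m)%N -> reach k x u -> adj u v -> 0 <= t <= 1 ->
  B (ept u v t).
Proof.
move=> km xu uv t01; split; first by right; exists u, v, t.
have rx w : @realization R X (vpt R w) by left; exists w.
have re w v' s : adj w v' -> 0 <= s <= 1 -> @realization R X (ept w v' s).
  by move=> wv s01; right; exists w, v', s.
have [i w v' s _ _|l xl lk] := reach_path (rx x) _ xu; first exact: re.
apply: (@le_trans _ _ (l + `|t - 0|)).
  apply/geod_dist_le/(pl_path_trans xl); rewrite -(ept0 R u v).
  apply: pl_path_seg => //; first by rewrite lexx ler01.
  move=> r; rewrite min_l ?max_r; try by case/andP: t01.
  by move=> /andP[r0 rt]; apply: re => //; lra.
have : (k%:R : R) <= m%:R by rewrite ler_nat.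
rewrite -natr1 subr0; case/andP: t01 => t0 t1; rewrite ger0_norm //.
by lra.
Qed.

Lemma ball_center : B (vpt R x).
Proof.
split; first by left; exists x.
apply: le_trans (ler0n _ _).
by apply/geod_dist_le/pl_nil; left; exists x.
Qed.

Lemma ball_path k u v t : (k <= m)%N -> reach k x u -> adj u v -> 0 <= t <= 1 ->
  exists2 l, pl_path B (vpt R x) (ept u v t) l & l <= k%:R + t.
Proof.
move=> km xu uv t01.
have [|i w v' s ik|l xl lk] := reach_path (A := B) _ _ xu; first exact: ball_center.
  by apply: in_ball; rewrite ltnW // (leq_trans ik).
exists (l + `|t - 0|).
  apply: (pl_path_trans xl); rewrite -(ept0 R u v).
  apply: pl_path_seg => //; first by rewrite lexx ler01.
  move=> r; rewrite min_l ?max_r; try by case/andP: t01.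
  by move=> /andP[r0 rt]; apply: (in_ball km) => //; lra.
rewrite subr0; case/andP: t01 => t0 t1; rewrite ger0_norm //.
by lra.
Qed.

(** A closed ball of integer radius is made of whole edges. An edge between two vertices at distance
    exactly [m + 1] has only its ends in the ball, which is why [chart] ignores such edges. *)
Lemma in_ballP p : B p -> p = vpt R x \/
  exists u v t, [/\ reach m x u, adj u v, 0 <= t <= 1 & p = ept u v t].
Proof.
move=> [rp dp]; have [l0 xp0] := realization_path rp.
have vP w : B (vpt R w) -> vpt R w = vpt R x \/
    exists u v t, [/\ reach m x u, adj u v, 0 <= t <= 1 & vpt R w = ept u v t].
  move=> [/realization_path[l1 xw1] dw].
  have [l xw lm] : exists2 l,
      pl_path (@realization R X) (vpt R x) (vpt R w) l & l < m.+2%:R.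
    by apply: geod_dist_lt xw1 _; apply: le_lt_trans dw _; rewrite ltr_nat.
  have [<-|[z xz zw]] := reachS_adj (path_vpt_reach (pl_path_sym xw) lm).
    by left.
  by right; exists z, w, 1; rewrite ept1 lexx ler01.
case: (rp) => [[w pw]|[u [v [t [uv /andP[t0 t1] pE]]]]].
  by rewrite pw; apply: vP; rewrite -pw.
move: t0 t1; rewrite le_eqVlt => /predU1P[t0 _|t0].
  by rewrite pE -t0 ept0; apply: vP; rewrite -(ept0 R u v) t0 -pE.
rewrite le_eqVlt => /predU1P[t1|t1].
  by rewrite pE t1 ept1; apply: vP; rewrite (_ : vpt R v = p) // pE t1 ept1.
right; have [l xp lm] : exists2 l,
    pl_path (@realization R X) (vpt R x) p l & l < m.+1%:R + Num.min t (1 - t).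
  apply: geod_dist_lt xp0 _; apply: le_lt_trans dp _.
  by rewrite ltrDl lt_min t0 subr_gt0.
move: xp; rewrite pE => /pl_path_sym xp.
have [|xu|xv] := path_ept_reach uv _ xp lm; first by rewrite t0.
  by exists u, v, t; rewrite !ltW.
exists v, u, (1 - t); rewrite -ept_rev; split=> //; first exact: adj_sym.
lra.
Qed.

Lemma ball_path_center p : B p ->
  exists2 l, pl_path B (vpt R x) p l & l <= m.+1%:R.
Proof.
move=> /in_ballP[->|[u [v [t [xu uv t01 ->]]]]].
  by exists 0 => //; apply/pl_nil/ball_center.
have [l xl lm] := ball_path (leqnn m) xu uv t01; exists l => //.
by rewrite -natr1; lra.
Qed.

Lemma ball_connected p q : B p -> B q -> exists l, pl_path B p q l.
Proof.
move=> /ball_path_center[l /pl_path_sym xp _] /ball_path_center[l' xq _].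
by exists (l + l'); apply: pl_path_trans xp xq.
Qed.

Lemma ball_vpt u : B (vpt R u) <-> reach m.+1 x u.
Proof.
split=> [/in_ballP[/vpt_inj ->|[v [w [t [xv vw _]]]]]|].
- exact: reach_refl.
- move=> /esym/(ept_vpt (adj_neq vw))[] [<- _]; first by left.
  exact: reach_adj vw.
- move=> /reachS_adj[<-|[z xz zu]]; first exact: ball_center.
  by rewrite -(ept1 R z u); apply: (in_ball (leqnn m)); rewrite ?ler01 ?lexx.
Qed.

Lemma ball_ept u v t : adj u v -> 0 < t < 1 ->
  B (ept u v t) <-> reach m x u \/ reach m x v.
Proof.
move=> uv t01; split=> [/in_ballP[|[u' [v' [t' [xu uv' _]]]]]|].
- move=> /(ept_vpt (adj_neq uv)) [] [_ t0]; lra.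
- by move=> /(ept_inj (adj_neq uv) (adj_neq uv') t01)[] [-> -> _]; [left|right].
- case=> [xu|xv]; first by apply: (in_ball (leqnn m)) => //; lra.
  by rewrite ept_rev; apply: (in_ball (leqnn m)) => //; [exact: adj_sym|lra].
Qed.

End Ball.

(** * Distances in balls *)

(* A chart at [x]: a bijection of the combinatorial ball of radius [m + 1]
   around [x] onto a ball of [Y] which is an isomorphism on all edges having an
   end in the ball of radius [m]. *)
Record chart (X Y : graph) (x : X) (m : nat) (phi : X -> Y) : Prop := Chart {
  chart_inj : forall u v, reach m.+1 x u -> reach m.+1 x v ->
    phi u = phi v -> u = v;
  chart_adj : forall u v, reach m x u -> reach m.+1 x v ->
    adj (phi u) (phi v) <-> adj u v;
  chart_surj : forall u w, reach m x u -> adj (phi u) w ->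
    exists2 v, reach m.+1 x v & phi v = w }.

Section Truncation.
Variable R : realType.
Implicit Types s t : R.

(** On an edge from [v] to [w] the difference of the two coordinates has slope 2. After truncation
    at 1/2 only one of them varies at a time, so the slope is 1. *)
Definition trunc_half s : R := Num.min s (1 / 2).
Local Notation h := trunc_half.

Lemma trunc_half_lip s t : `|h s - h t| <= `|t - s|.
Proof.
rewrite ler_norml /trunc_half; have := ler_norm (t - s); have := ler_norm (s - t).
by rewrite (distrC s t); case: (lerP s (1 / 2)) => ?; case: (lerP t (1 / 2)) => ?; lra.
Qed.

Lemma trunc_half_compl s : h (1 - s) - h s = 1 / 2 - s.
Proof.
by rewrite /trunc_half; case: (lerP s (1 / 2)) => ?; case: (lerP (1 - s) (1 / 2)) => ?; lra.
Qed.

End Truncation.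

Section Edges.
Variables (R : realType) (X : graph).
Implicit Types (x u v w z : X) (s t l : R) (p q : X -> R).

Lemma realization_supp p v w : v <> w -> realization p -> 0 < p v -> 0 < p w ->
  adj v w /\ p = ept v w (p w).
Proof.
move=> vw [[u ->]|[a [b [t [ab t01 ->]]]]].
  have supp z : 0 < vpt R u z -> z = u.
    by have [//|zu] := pselect (z = u); rewrite vpt_neq // ltxx.
  by move=> /supp vu /supp wu; case: vw; rewrite vu wu.
have anb := adj_neq ab.
have supp z : 0 < ept a b t z -> z = a \/ z = b.
  have [|za] := pselect (z = a); first by left.
  have [|zb] := pselect (z = b); first by right.
  by rewrite eptN // ltxx.
move=> /supp[] vE /supp[] wE; try by case: vw; rewrite vE wE.
  by rewrite vE wE eptr.
by rewrite vE wE eptl // -ept_rev; split=> //; apply: adj_sym.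
Qed.

Lemma coord_lip (A : set (X -> R)) p q w l : pl_path A p q l ->
  `|p w - q w| <= geod_dist A p q.
Proof.
move=> pq; apply: geod_dist_ge pq _ => {}l.
apply: (@pl_path_lip R X A (fun p => p w)) => u v s t uv _ _.
have unv := adj_neq uv.
have [->|wu] := pselect (w = u).
  by rewrite !eptl // opprB addrC subrKA.
have [->|wv] := pselect (w = v); first by rewrite !eptr // distrC.
by rewrite !eptN // subrr normr0.
Qed.

Local Notation h := (@trunc_half R).

(** The function [h (p v) - h (p w)] is 1-Lipschitz on every edge, even on one joining [v] and [w],
    and equals [t] and [-t] at the two points. *)
Lemma star_dist (A : set (X -> R)) u v w t l : adj u v -> adj u w -> v <> w ->
  0 <= t <= 1 / 2 -> pl_path A (ept u v t) (ept u w t) l ->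
  2 * t <= geod_dist A (ept u v t) (ept u w t).
Proof.
move=> uv uw vw t01 pq; apply: geod_dist_ge pq _ => {}l.
have Flip a b (s r : R) : adj a b -> 0 <= s <= 1 -> 0 <= r <= 1 ->
    `|(h (ept a b s v) - h (ept a b s w)) - (h (ept a b r v) - h (ept a b r w))|
    <= `|r - s|.
  move=> ab s01 r01; have anb := adj_neq ab.
  have h0 : h 0 = 0 by rewrite /trunc_half min_l //; lra.
  have [va|va] := pselect (v = a).
    have wa : w <> a by rewrite -va => /esym.
    rewrite va !(eptl _ anb); have [->|wb] := pselect (w = b).
      rewrite !(eptr _ anb). by rewrite !trunc_half_compl opprB addrC subrKA.
    rewrite !(eptN _ wa wb) h0 !subr0; apply: le_trans (trunc_half_lip _ _) _.
    by rewrite opprB addrC subrKA distrC.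
  have [vb|vb] := pselect (v = b).
    have wb : w <> b by rewrite -vb => /esym.
    rewrite vb !(eptr _ anb); have [->|wa] := pselect (w = a).
      rewrite !(eptl _ anb) -!(opprB (h (1 - _))) !trunc_half_compl !opprB.
      by rewrite addrA subrK distrC.
    by rewrite !(eptN _ wa wb) h0 !subr0 trunc_half_lip.
  rewrite !(eptN _ va vb) h0 !sub0r -opprD normrN.
  have [->|wa] := pselect (w = a).
    rewrite !(eptl _ anb); apply: le_trans (trunc_half_lip _ _) _.
    by rewrite opprB addrC subrKA distrC.
  have [->|wb] := pselect (w = b); first by rewrite !(eptr _ anb) trunc_half_lip.
  by rewrite !(eptN _ wa wb) subrr normr0.
move=> /(pl_path_lip (F := fun p => h (p v) - h (p w)) Flip).
have [unv unw] := (adj_neq uv, adj_neq uw).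
have -> : ept u v t w = 0 by apply: eptN => /esym.
have -> : ept u w t v = 0 by apply: eptN => // /esym.
rewrite (eptr _ unv) (eptr _ unw) /trunc_half !min_l; try lra.
by move=> /ler_normlW; lra.
Qed.

Variables (x : X) (m : nat).
Notation B := (cball x (m.+1%:R : R)).

Lemma ball_edge_dist u v t : reach m x u -> adj u v -> 0 <= t <= 1 ->
  geod_dist B (vpt R u) (ept u v t) <= t.
Proof.
move=> xu uv t01; have -> : t = `|t - 0|.
  by rewrite subr0 ger0_norm //; case/andP: t01.
rewrite [in X in _ <= X]subr0 -[X in _ <= `|X|]subr0 -(ept0 R u v).
rewrite [in ept u v `|_|]subr0 ger0_norm; last by case/andP: t01.
apply/geod_dist_le/pl_path_seg => //; first by rewrite lexx ler01.
case/andP: t01 => t0 t1 r; rewrite min_l ?max_r // => /andP[r0 rt].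
by apply: (in_ball (leqnn m)) => //; lra.
Qed.

Lemma ball_dist_lt1 u v : B (vpt R u) -> B (vpt R v) ->
  geod_dist B (vpt R u) (vpt R v) < 1 -> u = v.
Proof.
move=> Bu Bv; have [l uv] := ball_connected Bu Bv.
by case/(geod_dist_lt uv) => l' /path_vpt_reach + l1 => /(_ 0 l1) /esym.
Qed.

Lemma ball_dist_lt2 u v : B (vpt R u) -> B (vpt R v) ->
  geod_dist B (vpt R u) (vpt R v) < 2 -> u = v \/ adj u v.
Proof.
move=> Bu Bv; have [l uv] := ball_connected Bu Bv.
case/(geod_dist_lt uv) => l' /path_vpt_reach + l1 => /(_ 1 l1)/reach1[->|vu].
  by left.
by right; apply: adj_sym.
Qed.

End Edges.

(** * Isometries of metric balls *)

Section Isometry.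
Variables (R : realType) (X Y : graph) (x : X) (y : Y) (m : nat).
Notation A := (cball x (m.+1%:R : R)).
Notation B := (cball y (m.+1%:R : R)).
Variable f : (X -> R) -> (Y -> R).
Hypothesis f_bij : set_bij A B f.
Hypothesis f_dist : forall p q, A p -> A q ->
  geod_dist B (f p) (f q) = geod_dist A p q.
Hypothesis deg3 : forall u : X, exists v1 v2 v3,
  [/\ adj u v1, adj u v2, adj u v3 & [/\ v1 <> v2, v1 <> v3 & v2 <> v3]].

Let f_in p : A p -> B (f p).
Proof. by case: f_bij => + _ _; apply. Qed.

Let f_inj p q : A p -> A q -> f p = f q -> p = q.
Proof.
by case: f_bij => _ + _ => finj Ap Aq; apply: finj; apply/mem_set.
Qed.

Let f_surj q : B q -> exists2 p, A p & f p = q.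
Proof. by case: f_bij => _ _ /[apply]. Qed.

(* Three points at distance [e] from an interior point of an edge cannot be at
   mutual distance [2 e], contrary to those on the edges at a branch point. *)
Lemma iso_branch_vpt u : reach m x u -> exists w, f (vpt R u) = vpt R w.
Proof.
move=> xu; have Au : A (vpt R u) by apply/ball_vpt; left.
case: (in_ballP (f_in Au)) => [|[v [w [t [yv vw /andP[t0 t1] fu]]]]].
  by exists y.
have [t0'|t0'] := eqVneq t 0; first by exists v; rewrite fu t0' ept0.
have [t1'|t1'] := eqVneq t 1; first by exists w; rewrite fu t1' ept1.
have {t0'}t0 : 0 < t by rewrite lt_neqAle eq_sym t0'.
have {t1'}t1 : t < 1 by rewrite lt_neqAle t1'.
have nvw := adj_neq vw.
(* Half of the smallest of [t], [1 - t] and 1/2: points within [e] of [f u] stay inside the edge,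
   and [star_dist] applies. *)
exfalso; pose e : R := Num.min (Num.min t (1 - t)) (1 / 2) / 2.
have [e0 et et1 e12] : [/\ 0 < e, e < t, e < 1 - t & e <= 1 / 2].
  by rewrite /e; case: (lerP t (1 - t)) => h1;
    [case: (lerP t (1 / 2))|case: (lerP (1 - t) (1 / 2))] => h2; split; lra.
have e01 : 0 <= e <= 1 by lra.
have Aq v' : adj u v' -> A (ept u v' e).
  by move=> uv'; apply: (in_ball (leqnn m)).
(* Coordinates are 1-Lipschitz, so the images remain on the edge [v w] with parameters in an
   interval of length [2 e]; three such parameters cannot be pairwise [2 e] apart. *)
have fq v' : adj u v' -> exists2 s : R, t - e <= s <= t + e & f (ept u v' e) = ept v w s.
  move=> uv'; have Bq := f_in (Aq _ uv').
  have [l fl] := ball_connected (f_in Au) Bq.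
  have du := ball_edge_dist xu uv' e01.
  rewrite -(f_dist Au (Aq _ uv')) in du.
  have := le_trans (coord_lip v fl) du; have := le_trans (coord_lip w fl) du.
  rewrite fu eptl // eptr // !ler_norml => hw hv.
  have hs : t - e <= f (ept u v' e) w <= t + e by lra.
  have [||_ q] := realization_supp nvw (proj1 Bq); [lra|lra|].
  by exists (f (ept u v' e) w).
have seg s s' : t - e <= s <= t + e -> t - e <= s' <= t + e ->
    geod_dist B (ept v w s) (ept v w s') <= `|s' - s|.
  move=> hs hs'; apply/geod_dist_le/pl_path_seg => //; [lra|lra|].
  move=> r /andP[r0 r1]; apply: (in_ball (leqnn m)) => //.
  move: r0 r1; rewrite ge_min le_max => /orP[r0|r0] /orP[r1|r1]; lra.
have gap v1 v2 s1 s2 : adj u v1 -> adj u v2 -> v1 <> v2 ->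
    t - e <= s1 <= t + e -> t - e <= s2 <= t + e ->
    f (ept u v1 e) = ept v w s1 -> f (ept u v2 e) = ept v w s2 ->
    2 * e <= `|s2 - s1|.
  move=> uv1 uv2 v12 h1 h2 f1 f2; apply: le_trans (seg _ _ h1 h2).
  have [l l12] := ball_connected (Aq _ uv1) (Aq _ uv2).
  rewrite -f1 -f2 f_dist; [|exact: Aq|exact: Aq].
  by apply: star_dist l12 => //; lra.
have [v1 [v2 [v3 [uv1 uv2 uv3 [v12 v13 v23]]]]] := deg3 u.
have [s1 h1 f1] := fq _ uv1; have [s2 h2 f2] := fq _ uv2.
have [s3 h3 f3] := fq _ uv3.
have := gap _ _ _ _ uv1 uv2 v12 h1 h2 f1 f2.
have := gap _ _ _ _ uv1 uv3 v13 h1 h3 f1 f3.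
have := gap _ _ _ _ uv2 uv3 v23 h2 h3 f2 f3.
clear f1 f2 f3 fu; rewrite !ler_normr => /orP[] g1 /orP[] g2 /orP[] g3; lra.
Qed.

Let dist_lt1 u v : B (vpt R u) -> B (vpt R v) ->
  geod_dist B (vpt R u) (vpt R v) < 1 -> u = v.
Proof. exact: ball_dist_lt1. Qed.

(** Degrees in [Y] are not controlled, so the argument for branch points cannot be run backwards.
    Instead, a preimage of [w] that is not a vertex is at distance less than 1 from an inner vertex
    [u]; then the vertex [f u] is at distance less than 1 from [w], hence equal to it. *)
Lemma iso_vpt_surj w : B (vpt R w) -> exists2 u, A (vpt R u) & f (vpt R u) = vpt R w.
Proof.
move=> Bw; have [p Ap fp] := f_surj Bw.
case: (in_ballP Ap) => [px|[u [v [t [xu uv t01 pE]]]]].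
  by exists x; rewrite -px.
have Au : A (vpt R u) by apply/ball_vpt; left.
have [t1|t1] := eqVneq t 1; first by exists v; rewrite -(ept1 R u v) -[X in ept _ _ X]t1 -pE.
exists u => //; have [u' fu] := iso_branch_vpt xu.
rewrite fu; congr vpt; apply: dist_lt1 => //; first by rewrite -fu; apply: f_in.
rewrite -fu -fp f_dist // pE; apply: le_lt_trans (ball_edge_dist xu uv t01) _.
by rewrite lt_neqAle t1; case/andP: t01.
Qed.

(** This also covers the vertices on the boundary of the ball: if [f u] is not a vertex, it is
    closer than 1 to an inner vertex [v], and the preimage of [v] is a vertex that must be [u]. *)
Lemma iso_vpt u : A (vpt R u) -> exists w, f (vpt R u) = vpt R w.
Proof.
move=> Au; case: (in_ballP (f_in Au)) => [|[v [w [t [yv vw t01 fu]]]]].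
  by exists y.
have Bv : B (vpt R v) by apply/ball_vpt; left.
have [t1|t1] := eqVneq t 1; first by exists w; rewrite fu t1 ept1.
have [u' Au' fu'] := iso_vpt_surj Bv.
exists v; rewrite -fu'; congr (f (vpt R _)); apply: (ball_dist_lt1 Au Au').
rewrite -f_dist // geod_dist_sym fu fu'.
apply: le_lt_trans (ball_edge_dist yv vw t01) _.
by rewrite lt_neqAle t1; case/andP: t01.
Qed.

Lemma iso_vertex_map : exists F : X -> Y,
  forall u, reach m.+1 x u -> f (vpt R u) = vpt R (F u).
Proof.
have /choice[F FP] u : exists w, reach m.+1 x u -> f (vpt R u) = vpt R w.
  have [/(ball_vpt R)/iso_vpt[w fw]|nu] := pselect (reach m.+1 x u).
    by exists w.
  by exists y.
by exists F.
Qed.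

Variable F : X -> Y.
Hypothesis fF : forall u, reach m.+1 x u -> f (vpt R u) = vpt R (F u).

Lemma iso_map_inj u v : reach m.+1 x u -> reach m.+1 x v -> F u = F v -> u = v.
Proof.
move=> xu xv e; apply: (@vpt_inj R); apply: f_inj; try exact/ball_vpt.
by rewrite !fF // e.
Qed.

Lemma iso_map_surj w : reach m.+1 y w -> exists2 u, reach m.+1 x u & F u = w.
Proof.
move=> /(ball_vpt R)/iso_vpt_surj[u /ball_vpt xu]; rewrite fF //.
by move=> /vpt_inj; exists u.
Qed.

Lemma iso_map_adj u v : adj u v -> reach m x u \/ reach m x v -> adj (F u) (F v).
Proof.
wlog xu : u v / reach m x u => [hw uv [xu|xv]|uv _].
- by apply: hw => //; left.
- by apply/adj_sym/hw => //; [exact: adj_sym|left].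
have xu' : reach m.+1 x u by left.
have xv := reach_adj xu uv.
have [Au Av] : A (vpt R u) /\ A (vpt R v) by split; apply/ball_vpt.
have d1 : geod_dist A (vpt R u) (vpt R v) < 2.
  rewrite -(ept1 R u v); apply: le_lt_trans (ball_edge_dist xu uv _) _.
    by rewrite ler01 lexx.
  lra.
rewrite -f_dist // !fF // in d1.
have [//||/(iso_map_inj xu' xv) e|//] := ball_dist_lt2 _ _ d1.
- by rewrite -fF //; apply: f_in.
- by rewrite -fF //; apply: f_in.
- by case: (adj_neq uv).
Qed.

Lemma iso_map_adj_inv u v : reach m.+1 x u -> reach m.+1 x v ->
  adj (F u) (F v) -> reach m y (F u) -> adj u v.
Proof.
move=> xu xv uv yu.
have [Au Av] : A (vpt R u) /\ A (vpt R v) by split; apply/ball_vpt.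
have d1 : geod_dist B (f (vpt R u)) (f (vpt R v)) < 2.
  rewrite !fF // -(ept1 R (F u) (F v)).
  apply: le_lt_trans (ball_edge_dist yu uv _) _; first by rewrite ler01 lexx.
  lra.
rewrite f_dist // in d1.
by case: (ball_dist_lt2 Au Av d1) uv => [->|//] /adj_irrefl.
Qed.

(** The isometry need not respect centres. The midpoint of an edge of the ball at [x] is sent within
    [m + 1] of [y], so it is within [m + 1] of [x'], and an end of the edge is within [m] of
    [x']. *)
Lemma iso_center_edges x' u v : reach m.+1 x x' -> F x' = y -> adj u v ->
  reach m x u \/ reach m x v -> reach m x' u \/ reach m x' v.
Proof.
have t01 : 0 < 1 / 2 :> R /\ 1 / 2 < 1 :> R by split; lra.
have h12 : Num.min (1 / 2) (1 - 1 / 2) = 1 / 2 :> R.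
  by apply/min_l; lra.
move=> xx' Fx' uv xuv.
have {}t01 : 0 < (1 / 2 : R) < 1 by apply/andP.
have AM : A (ept u v (1 / 2 : R)) by apply/ball_ept.
have Ax' : A (vpt R x') by apply/ball_vpt.
have [l yl lm] := ball_path_center (f_in AM).
have d1 : geod_dist A (vpt R x') (ept u v (1 / 2)) < m.+1%:R + 1 / 2.
  rewrite -f_dist // fF // Fx'; apply: le_lt_trans (geod_dist_le yl) _.
  by apply: le_lt_trans lm _; rewrite ltrDl; case/andP: t01.
have [l0 xl0] := ball_connected Ax' AM.
have [l1 xl1 lm1] := geod_dist_lt xl0 d1.
apply: (path_ept_reach uv t01 (pl_path_sym xl1)).
by rewrite h12.
Qed.

Lemma iso_chart x' : reach m.+1 x x' -> F x' = y ->
  (forall u v, adj u v -> reach m x' u \/ reach m x' v ->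
     reach m x u \/ reach m x v) ->
  chart x' m F.
Proof.
move=> xx' Fx' ball_x'.
have nbh u v : adj u v -> reach m x' u -> reach m.+1 x u /\ reach m.+1 x v.
  move=> uv xu; have [|xu'|xv'] := ball_x' _ _ uv; first by left.
    by split; [left|exact: reach_adj uv].
  by split; [apply: reach_adj xv' (adj_sym uv)|left].
have sub u : reach m.+1 x' u -> reach m.+1 x u.
  by move=> /reachS_adj[<-//|[z xz zu]]; case: (nbh _ _ zu xz).
have Fadj u v : adj u v -> reach m x' u -> adj (F u) (F v).
  by move=> uv xu; apply: iso_map_adj => //; apply: ball_x' => //; left.
have Freach k u : (k <= m)%N -> reach k x' u -> reach k y (F u).
  elim: k u => [u _ <-|k IHk u km]; first by rewrite Fx'.
  case=> [xu|[z xz zu]]; first by left; apply: IHk => //; rewrite ltnW.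
  apply: reach_adj (Fadj _ _ zu _); first by apply: IHk => //; rewrite ltnW.
  by apply: reach_le xz; rewrite ltnW.
split.
- by move=> u v xu xv; apply: iso_map_inj; apply: sub.
- move=> u v xu xv; split=> [uv|uv]; last exact: Fadj.
  apply: iso_map_adj_inv uv _; [by apply: sub; left|exact: sub|].
  exact: Freach.
- move=> u w xu uw; have yu := Freach _ _ (leqnn m) xu.
  have [v xv vw] := iso_map_surj (reach_adj yu uw); exists v => //.
  have uv : adj u v.
    by apply: iso_map_adj_inv => //; [apply: sub; left|rewrite vw].
  exact: reach_adj uv.
Qed.

End Isometry.

(** The ball at [x'], the vertex sent to [y], may stick out of the ball at [x], where [F] is
    meaningful. The inclusion that excludes this is left as a premise, to be derived from the
    opposite one by homogeneity. *)
Lemma isometric_chart (R : realType) (X Y : graph) (x : X) (y : Y) (m : nat) :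
  (forall u : X, exists v1 v2 v3,
     [/\ adj u v1, adj u v2, adj u v3 & [/\ v1 <> v2, v1 <> v3 & v2 <> v3]]) ->
  isometric (cball x (m.+1%:R : R)) (geod_dist (cball x m.+1%:R))
            (cball y m.+1%:R) (geod_dist (cball y m.+1%:R)) ->
  exists x' F, [/\ F x' = y,
    forall u v, adj u v -> reach m x u \/ reach m x v ->
      reach m x' u \/ reach m x' v &
    (forall u v, adj u v -> reach m x' u \/ reach m x' v ->
       reach m x u \/ reach m x v) -> chart x' m F].
Proof.
move=> deg3 [f fbij fdist].
have [F fF] := iso_vertex_map fbij fdist deg3.
have [x' xx' Fx'] := iso_map_surj fbij fdist deg3 fF (reach_refl m.+1 y).
exists x', F; split=> //.
  by move=> u v uv; apply: (iso_center_edges fbij fdist fF xx' Fx' uv).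
exact: (iso_chart fbij fdist).
Qed.

(** * Charts *)

Section Charts.
Variables (X Y : graph) (x : X) (m : nat) (phi : X -> Y).
Hypothesis phiP : chart x m phi.

Lemma chart_reach k u : (k <= m.+1)%N -> reach k x u -> reach k (phi x) (phi u).
Proof.
elim: k u => [u _ <-//|k IHk u km [xu|[z xz zu]]].
  by left; apply: IHk => //; rewrite ltnW.
apply: reach_adj (IHk _ (ltnW km) xz) _.
have xz' : reach m x z by apply: reach_le xz.
by apply/(chart_adj phiP) => //; apply: reach_adj zu.
Qed.

Lemma chart_reach_surj k w : (k <= m.+1)%N -> reach k (phi x) w ->
  exists2 u, reach k x u & phi u = w.
Proof.
elim: k w => [w _ <-|k IHk w km [xw|[z xz zw]]]; first by exists x.
  by have [u xu <-] := IHk _ (ltnW km) xw; exists u => //; left.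
have [u xu uz] := IHk _ (ltnW km) xz.
have xu' : reach m x u by apply: reach_le xu.
move: zw; rewrite -uz => zw; have [v xv vw] := chart_surj phiP xu' zw.
exists v => //; apply: reach_adj xu _.
by apply/(chart_adj phiP) => //; rewrite vw.
Qed.

Lemma chart_le m' : (m' <= m)%N -> chart x m' phi.
Proof.
move=> mm; split.
- by move=> u v xu xv; apply: (chart_inj phiP); [apply: reach_le xu|apply: reach_le xv].
- by move=> u v xu xv; apply: (chart_adj phiP); [apply: reach_le xu|apply: reach_le xv].
- move=> u w xu uw; have xu' : reach m x u by apply: reach_le xu.
  have [v xv vw] := chart_surj phiP xu' uw; exists v => //.
  by apply: reach_adj xu _; apply/(chart_adj phiP) => //; rewrite vw.
Qed.

Lemma chart_recenter x' j m' : reach j x x' -> (j + m' <= m)%N -> chart x' m' phi.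
Proof.
move=> xx' jm.
have r k u : (k <= m'.+1)%N -> reach k x' u -> reach (j + k) x u.
  by move=> _; apply: reach_trans.
have r0 u : reach m' x' u -> reach m x u.
  by move/(reach_trans xx'); apply: reach_le.
have r1 u : reach m'.+1 x' u -> reach m.+1 x u.
  by move/(reach_trans xx'); apply: reach_le; rewrite addnS.
split.
- by move=> u v /r1 xu /r1 xv; apply: (chart_inj phiP).
- by move=> u v /r0 xu /r1 xv; apply: (chart_adj phiP).
- move=> u w xu uw; have [v xv vw] := chart_surj phiP (r0 _ xu) uw; exists v => //.
  have uv : adj u v by apply/(chart_adj phiP (r0 _ xu) xv); rewrite vw.
  exact: reach_adj xu uv.
Qed.

Lemma chart_inverse : exists2 psi : Y -> X, chart (phi x) m psi &
  forall u, reach m.+1 x u -> psi (phi u) = u.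
Proof.
have /choice[psi psiP] w : exists u, reach m.+1 (phi x) w ->
    reach m.+1 x u /\ phi u = w.
  have [/(chart_reach_surj (leqnn _))[u xu uw]|nw] := pselect (reach m.+1 (phi x) w).
    by exists u.
  by exists x.
have psiK u : reach m.+1 x u -> psi (phi u) = u.
  move=> xu; have [xu' e] := psiP _ (chart_reach (leqnn _) xu).
  exact: (chart_inj phiP).
exists psi => //; split.
- move=> w w' /psiP[_ e] /psiP[_ e'] ww'.
  by rewrite -e -e' ww'.
- move=> w w' /(chart_reach_surj (leqnSn _))[u xu <-].
  move=> /(chart_reach_surj (leqnn _))[u' xu' <-].
  rewrite !psiK //; last by left.
  by split=> /(chart_adj phiP xu xu').
- move=> w v /(chart_reach_surj (leqnSn _))[u xu <-]; rewrite psiK; last by left.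
  move=> uv; have xv := reach_adj xu uv; exists (phi v); last exact: psiK.
  exact: chart_reach.
Qed.

End Charts.

Lemma chart_comp (X Y Z : graph) (x : X) (m : nat) (phi : X -> Y) (psi : Y -> Z) :
  chart x m phi -> chart (phi x) m psi -> chart x m (psi \o phi).
Proof.
move=> phiP psiP; split=> /=.
- move=> u v xu xv e; apply: (chart_inj phiP) => //.
  by apply: (chart_inj psiP) => //; apply: (chart_reach phiP).
- move=> u v xu xv; rewrite -(chart_adj phiP xu xv); apply: (chart_adj psiP).
    exact: (chart_reach phiP).
  exact: (chart_reach phiP).
- move=> u w xu uw.
  have [v xv vw] := chart_surj psiP (chart_reach phiP (leqnSn _) xu) uw.
  have [v' xv' vE] := chart_reach_surj phiP (leqnn _) xv.
  by exists v' => //; rewrite vE.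
Qed.

(** * Charts of Cayley graphs *)

Section CayleyCharts.
Local Open Scope group_scope.
Variables (G : groupType) (S : seq G) (HS : sym_generating S).
Notation X := (cayley HS).

Lemma cayley_adj_mul (g u v : G) :
  adj (g * u : X) (g * v : X) <-> adj (u : X) (v : X).
Proof. by rewrite /= /cayley_adj invgM -mulgA mulKg. Qed.

Lemma reach_mul k (g u v : G) : reach k (u : X) v -> reach k (g * u : X) (g * v).
Proof.
elim: k v => [v ->//|k IHk v [/IHk|[z /IHk uz zv]]]; first by left.
by apply: reach_adj uz _; apply/cayley_adj_mul.
Qed.

Lemma chart_mul (g x : G) m : chart (x : X) m (mul g : X -> X).
Proof.
split=> [u v _ _|u v _ _|u w xu uw]; [exact: mulgI|exact: cayley_adj_mul|].
exists (g^-1 * w); last by rewrite mulKVg.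
by apply: reach_adj xu _; apply/(cayley_adj_mul g); rewrite mulKVg.
Qed.

Lemma reach_seq k (x : X) : exists L : seq G, forall u, reach k x u -> u \in L.
Proof.
elim: k => [|k [L LP]]; first by exists [:: x] => u <-; rewrite mem_head.
exists (L ++ [seq z * s | z <- L, s <- S]) => u; rewrite mem_cat.
case=> [/LP ->//|[z /LP zL /cayley_adjP[zu _]]]; apply/orP; right.
by apply/allpairsP; exists (z, z^-1 * u); rewrite /= mulKVg.
Qed.

(* The edge set of the ball at [x] is finite and [x x'^-1] maps it into itself. *)
Lemma cayley_ball_edges m (x x' : G) :
  (forall u v, adj (u : X) (v : X) -> reach m (x : X) u \/ reach m (x : X) v ->
     reach m (x' : X) u \/ reach m (x' : X) v) ->
  forall u v, adj (u : X) (v : X) -> reach m (x' : X) u \/ reach m (x' : X) v ->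
     reach m (x : X) u \/ reach m (x : X) v.
Proof.
pose E (c : G) (e : G * G) := adj (e.1 : X) (e.2 : X) /\
  (reach m (c : X) e.1 \/ reach m (c : X) e.2).
move=> sub; have {}sub e : E x e -> E x' e.
  by move=> [adje xe]; split=> //; apply: sub.
suff sub' e : E x' e -> E x e.
  by move=> u v uv xuv; case: (sub' (u, v)).
have [L LP] : exists L : seq (G * G), forall e, E x e <-> e \in L.
  have [L LP] := reach_seq m.+1 (x : X).
  exists [seq e <- [seq (u, v) | u <- L, v <- L] | `[<E x e>]] => c.
  rewrite mem_filter; split=> [Ee|/andP[/asboolP//]].
  apply/andP; split; first exact/asboolP.
  case: Ee => uv xuv; apply/allpairsP; exists c; split; last by case: (c).
    apply: LP; case: xuv => [xu|xv]; first by left.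
    by apply: reach_adj xv _; apply: adj_sym.
  by apply: LP; case: xuv => [xu|xv]; [apply: reach_adj uv|left].
pose tau (e : G * G) := (x * x'^-1 * e.1, x * x'^-1 * e.2).
have tau_inj : injective tau.
  by move=> [a b] [c d] [/mulgI -> /mulgI ->].
have tauE c : E x' c -> E x (tau c).
  move=> [uv xuv]; split; first exact/cayley_adj_mul.
  by case: xuv => /(reach_mul (x * x'^-1)); rewrite mulgVK; [left|right].
move=> Ee; have := tauE _ Ee; move/LP.
(* Hence [tau] permutes the edges at [x]; as [tau] is injective, an edge sent to one of them is
   itself one of them. *)
have tauL : {subset [seq tau e | e <- undup L] <= undup L}.
  move=> _ /mapP[e' + ->]; rewrite !mem_undup => /LP/sub/tauE; exact: (LP _).1.
have utau : uniq [seq tau e | e <- undup L] by rewrite map_inj_uniq // undup_uniq.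
have [_ eqL] := uniq_min_size utau tauL ltac:(by rewrite size_map).
rewrite -mem_undup -eqL => /mapP[e']; rewrite mem_undup => + /tau_inj ->.
exact: (LP _).2.
Qed.

(** Three labels make all degrees at least three, [cayley_ball_edges] supplies the missing
    inclusion, and a translation moves the centre to 1. *)
Lemma cayley_chart (R : realType) (Y : graph) m :
  (exists s1 s2 s3, [/\ s1 \in S, s2 \in S, s3 \in S,
     uniq [:: s1; s2; s3] & 1 \notin [:: s1; s2; s3]]) ->
  is_locally (m.+1%:R : R)%R X Y ->
  forall y : Y, exists2 phi : X -> Y, phi 1 = y & chart (1 : X) m phi.
Proof.
move=> [s1 [s2 [s3 [S1 S2 S3 us s0]]]] loc y; have [x iso] := loc y.
have adjs s (u : G) : s \in S -> s != 1 -> adj (u : X) (u * s : X).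
  move=> sS s1'; apply/cayley_adjP; rewrite mulKg; split=> //.
  by apply: contra s1' => /eqP e; rewrite -(can_eq (mulKg u)) mulg1 -e.
move: us s0; rewrite /= !inE !negb_or !(eq_sym 1) andbT.
move=> /andP[/andP[s12 s13] s23] /and3P[s10 s20 s30].
have deg3 (u : X) : exists v1 v2 v3 : X,
    [/\ adj u v1, adj u v2, adj u v3 & [/\ v1 <> v2, v1 <> v3 & v2 <> v3]].
  exists (u * s1), (u * s2), (u * s3); split; try exact: adjs.
  by split=> /mulgI /eqP; apply/negP.
have [x' [F [Fx' sub]]] := isometric_chart deg3 iso.
move=> /(_ (cayley_ball_edges sub)) Fchart.
exists (F \o mul x'); first by rewrite /= mulg1.
by apply: chart_comp (chart_mul _ _ _) _; rewrite mulg1.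
Qed.

End CayleyCharts.

(** * Generating sets recognized by triangles *)

Ltac gsimp :=
  rewrite ?(invgM, invgK, invg1, mulgA, mulg1, mul1g, mulgV, mulVg, mulgK, mulgVK).

Section Triangles.
Local Open Scope group_scope.
Variables (G : groupType) (a : G).
Hypothesis a_inf : infinite_order a.
Implicit Types (S T P L W : seq G) (s t e b x y : G).

Lemma expg_inj : injective (fun k => a ^+ k).
Proof.
have lt_neq i j : (i < j)%N -> a ^+ i <> a ^+ j.
  move=> ij e; have /negP[] := a_inf (etrans (subn_gt0 i j) ij).
  by rewrite expgnFr 1?ltnW // e mulgV.
by move=> i j e; case: (ltngtP i j) => // /lt_neq; rewrite e.
Qed.

Lemma eventually_notin (f : nat -> G) W : injective f ->
  exists K, forall k, (K <= k)%N -> f k \notin W.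
Proof.
move=> f_inj; elim: W => [|w W [K KP]]; first by exists 0.
have [[k0 fk0]|nf] := pselect (exists k, f k = w); last first.
  exists K => k /KP fk; rewrite inE negb_or fk andbT.
  by apply/eqP => fkw; apply: nf; exists k.
exists (maxn K k0.+1) => k; rewrite geq_max => /andP[/KP fk k0k].
rewrite inE negb_or fk andbT -fk0; apply/eqP => /f_inj kk0.
by rewrite kk0 ltnn in k0k.
Qed.

(** For such [s] and [b] a power of [a ^+ M], the product [b^-1 s b^-1] is [s] whatever [b] is: the
    one coincidence that forces the squares of [s] into [affected]. *)
Definition inverts_power s : Prop :=
  exists2 M, (0 < M)%N & (a ^+ M) ^ s = (a ^+ M)^-1.

Lemma inverts_powerV s : inverts_power s -> inverts_power s^-1.
Proof.
move=> [M M0 e]; exists M => //; apply: invg_inj.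
by rewrite invgK -conjVg -e conjgK.
Qed.

(** The square of [s] commutes with [a ^+ M]; inverting [a ^+ N] as well, it would give
    [a ^+ (2 M N) = 1]. *)
Lemma inverts_power_sqr s : inverts_power s -> ~ inverts_power (s * s).
Proof.
move=> [M M0 e] [N N0 e']; have := congr1 (fun x => x ^+ M) e'.
rewrite -conjXg expVgn -!expgnA mulnC expgnA conjXg conjgM e conjVg e invgK.
rewrite -expgnA => /eqP; rewrite -mulg_eq1 -expgnDr.
by apply/negP/a_inf; rewrite addn_gt0 muln_gt0 M0 N0.
Qed.

(** If [s] commutes with some [a ^+ M], or else inverts one, take [b] among its powers: one of the
    last two products is then [s] and the other is [s] times [b^-2] or [b^2]. Otherwise both
    products are injective in the exponent of [a]. An injective sequence eventually leaves the
    finite set [W]. *)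
Lemma generic_power W s : exists b, [/\ b \notin W, b * b \notin W,
  b^-1 * s * b = s \/ b^-1 * s * b \notin W &
  (inverts_power s /\ b^-1 * s * b^-1 = s) \/ b^-1 * s * b^-1 \notin W].
Proof.
have scaled M : (0 < M)%N -> injective (fun k => a ^+ (M * k)).
  by move=> M0 i j /expg_inj/eqP; rewrite eqn_pmul2l // => /eqP.
have scaled2 M : (0 < M)%N -> injective (fun k => a ^+ (M * k) * a ^+ (M * k)).
  move=> M0 i j; rewrite -!expgnDr -!mulnDr => /scaled -/(_ M0).
  by rewrite !addnn => /double_inj.
have [[M M0 cM]|nc] := pselect (exists2 M, (0 < M)%N & (a ^+ M) ^ s = a ^+ M).
  have [K1 H1] := eventually_notin W (scaled M M0).
  have [K2 H2] := eventually_notin W (scaled2 M M0).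
  have [|K3 H3] := @eventually_notin (fun k => s * (a ^+ (M * k) * a ^+ (M * k))^-1) W.
    by move=> i j /mulgI/invg_inj/scaled2; apply.
  pose k := maxn K1 (maxn K2 K3).
  have cs : (a ^+ (M * k)) ^ s = a ^+ (M * k) by rewrite expgnA conjXg cM.
  have {}cs : a ^+ (M * k) * s = s * a ^+ (M * k) by rewrite (conjgC (a ^+ (M * k))) cs.
  exists (a ^+ (M * k)); split.
  - by apply: H1; rewrite leq_maxl.
  - by apply: H2; rewrite !leq_max leqnn orbT.
  - by left; rewrite -mulgA -cs mulKg.
  - right; have := H3 k; rewrite !leq_max leqnn !orbT => /(_ isT).
    suff -> : (a ^+ (M * k))^-1 * s * (a ^+ (M * k))^-1 =
      s * (a ^+ (M * k) * a ^+ (M * k))^-1 by [].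
    apply: (mulgI (a ^+ (M * k))).
    by gsimp; rewrite cs; gsimp.
have [[M M0 iM]|ni] := pselect (inverts_power s).
  have [K1 H1] := eventually_notin W (scaled M M0).
  have [K2 H2] := eventually_notin W (scaled2 M M0).
  have [|K3 H3] := @eventually_notin (fun k => s * (a ^+ (M * k) * a ^+ (M * k))) W.
    by move=> i j /mulgI/scaled2; apply.
  pose k := maxn K1 (maxn K2 K3).
  have cs : (a ^+ (M * k)) ^ s = (a ^+ (M * k))^-1.
    by rewrite expgnA conjXg iM expVgn.
  have {}cs : a ^+ (M * k) * s = s * (a ^+ (M * k))^-1 by rewrite (conjgC (a ^+ (M * k))) cs.
  exists (a ^+ (M * k)); split.
  - by apply: H1; rewrite leq_maxl.
  - by apply: H2; rewrite !leq_max leqnn orbT.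
  - right; have := H3 k; rewrite !leq_max leqnn !orbT => /(_ isT).
    suff -> : (a ^+ (M * k))^-1 * s * a ^+ (M * k) =
      s * (a ^+ (M * k) * a ^+ (M * k)) by [].
    apply: (mulgI (a ^+ (M * k))).
    by gsimp; rewrite cs; gsimp.
  - by left; split; [exists M|rewrite -mulgA -cs mulKg].
have expgB i j : (i < j)%N -> a ^+ j = a ^+ (j - i) * a ^+ i /\
    a ^+ j = a ^+ i * a ^+ (j - i).
  by move=> ij; rewrite -!expgnDr addnC subnKC // ltnW.
have inj_lt (f : nat -> G) : (forall i j, (i < j)%N -> f i <> f j) -> injective f.
  by move=> lt_neq i j e; case: (ltngtP i j) => // /lt_neq; rewrite e.
have inj1 : injective (fun k => (a ^+ k)^-1 * s * a ^+ k).
  apply: inj_lt => i j ij; rewrite (expgB _ _ ij).1 invgM !mulgA => /mulIg.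
  rewrite -!mulgA => /mulgI e; apply: nc; exists (j - i)%N; first by rewrite subn_gt0.
  by apply: (mulgI s); rewrite -conjgC {1}e; gsimp.
have inj2 : injective (fun k => (a ^+ k)^-1 * s * (a ^+ k)^-1).
  apply: inj_lt => i j ij; rewrite {1}(expgB _ _ ij).1 {1}(expgB _ _ ij).2.
  rewrite !invgM !mulgA => /mulIg; rewrite -!mulgA => /mulgI e.
  apply: ni; exists (j - i)%N; first by rewrite subn_gt0.
  by apply: (mulgI s); rewrite -conjgC {1}e; gsimp.
have [K1 H1] := eventually_notin W (scaled 1%N isT).
have [K2 H2] := eventually_notin W (scaled2 1%N isT).
have [K3 H3] := eventually_notin W inj1.
have [K4 H4] := eventually_notin W inj2.
pose k := maxn (maxn K1 K2) (maxn K3 K4); exists (a ^+ k); split.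
- by have := H1 k; rewrite mul1n; apply; rewrite !leq_max leqnn.
- by have := H2 k; rewrite mul1n; apply; rewrite !leq_max leqnn orbT.
- by right; apply: H3; rewrite !leq_max leqnn orbT.
- by right; apply: H4; rewrite !leq_max leqnn !orbT.
Qed.

Definition sym_closed S : Prop := forall x, x \in S -> x^-1 \in S.

(* The number of triangles containing a given edge labelled [t] in the Cayley
   graph of [S]. *)
Definition triangles S t : nat := size [seq z <- undup S | t^-1 * z \in S].

Lemma triangles_eq S S' t : {subset S <= S'} ->
  (forall z, z \in S' -> t^-1 * z \in S' -> z \in S /\ t^-1 * z \in S) ->
  triangles S' t = triangles S t.
Proof.
move=> sub tri; apply/perm_size/uniq_perm; rewrite ?filter_uniq ?undup_uniq //.
move=> z; rewrite !mem_filter !mem_undup; apply/idP/idP => /andP[tz zS].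
  by case: (tri z zS tz) => -> ->.
by rewrite !sub.
Qed.

Lemma triangles_lt S S' t z : {subset S <= S'} ->
  z \in S' -> t^-1 * z \in S' -> z \notin S -> (triangles S t < triangles S' t)%N.
Proof.
move=> sub zS' tz zS.
rewrite /triangles -[(size _).+1]/(size (z :: [seq z <- undup S | t^-1 * z \in S])).
apply: uniq_leq_size => [|y].
  by rewrite /= mem_filter mem_undup (negPf zS) andbF filter_uniq ?undup_uniq.
rewrite inE !mem_filter !mem_undup => /predU1P[->|/andP[ty yS]].
  by rewrite tz.
by rewrite !sub.
Qed.

Lemma trianglesV S t : triangles S t^-1 = triangles S t.
Proof.
suff le u : (triangles S u <= triangles S u^-1)%N.
  by apply/eqP; rewrite eqn_leq le -{2}(invgK t) le.
rewrite /triangles -(size_map (mul u^-1)).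
apply: uniq_leq_size; first by rewrite (map_inj_uniq (mulgI _)) filter_uniq ?undup_uniq.
move=> _ /mapP[z + ->]; rewrite !mem_filter !mem_undup => /andP[uz zS].
by rewrite invgK mulVKg zS.
Qed.

(* The labels whose triangle count may change when the triangles [s = b (b^-1 s)]
   are added: when [b] is inverted by [s], also [(b^-1 s)^2 = s^2]. *)
Definition affected s t : Prop :=
  [\/ t = s, t = s^-1 | inverts_power s /\ (t = s * s \/ t = (s * s)^-1)].

(** Add [b], [b^-1 s] and their inverses for a generic power [b] of [a]. New labels are not products
    of two old ones, so a new triangle on an old edge [t] writes [t] as a product of two new labels;
    this makes [t] affected. *)
Lemma add_triangle S s : sym_closed S -> 1 \notin S -> s \in S ->
  exists S', [/\ {subset S <= S'}, sym_closed S', 1 \notin S' &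
    [/\ forall e, e \in S' -> e \notin S ->
          (triangles S' e <= 8)%N /\ (forall x y, x \in S -> y \in S -> e != x * y),
        forall t, t \in S -> ~ affected s t -> triangles S' t = triangles S t &
        (triangles S s < triangles S' s)%N]].
Proof.
move=> symS S1 sS; have sVS := symS _ sS.
(* [P] and [W] hold the products of at most two and at most four labels. A new label in [P] would
   put [b] in [W]. *)
pose P := [seq x * y | x <- 1 :: S, y <- 1 :: S].
pose W := [seq x * y | x <- P, y <- P].
have P_1 : 1 \in P by rewrite -(mulg1 1); apply: allpairs_f; rewrite mem_head.
have P_mul x y : x \in S -> y \in S -> x * y \in P.
  by move=> xS yS; apply: allpairs_f; rewrite inE ?xS ?yS orbT.
have P_S x : x \in S -> x \in P.
  by move=> xS; rewrite -(mulg1 x); apply: allpairs_f; rewrite inE ?xS ?eqxx ?orbT.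
have W_mul x y : x \in P -> y \in P -> x * y \in W by apply: allpairs_f.
have W_P x : x \in P -> x \in W by move=> xP; rewrite -(mulg1 x) W_mul.
have [b [bW bbW conj twist]] := generic_power W s.
pose E := [:: b; b^-1; b^-1 * s; s^-1 * b].
have symE e : e \in E -> e^-1 \in E.
  by rewrite !inE => /or4P[]/eqP ->; gsimp; rewrite eqxx ?orbT.
have P_inv x : x \in P -> x^-1 \in P.
  have inv1 z : z \in 1 :: S -> z^-1 \in 1 :: S.
    by rewrite !inE => /predU1P[->|/symS ->]; rewrite ?invg1 ?eqxx ?orbT.
  rewrite {1}/P => /allpairsP[[y z] /= [yS zS ->]]; rewrite invgM.
  by apply: allpairs_f; apply: inv1.
have E_P e : e \in E -> e \notin P.
  rewrite !inE => /or4P[]/eqP -> {e}; apply: contra bW.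
  - exact: W_P.
  - by move=> /P_inv; rewrite invgK; apply: W_P.
  - move=> /P_inv eP; have -> : b = s * (b^-1 * s)^-1 by gsimp.
    by apply: W_mul => //; apply: P_S.
  - move=> eP; have -> : b = s * (s^-1 * b) by gsimp.
    by apply: W_mul => //; apply: P_S.
have E_S e : e \in E -> e \notin S by move/E_P; apply: contra; apply: P_S.
have bbP t : b * b = t -> t \in P -> False.
  by move=> <- /W_P bb; rewrite bb in bbW.
have conjP t : b^-1 * s * b = t -> t \in S -> t = s.
  move=> e tS; case: conj => [e2|]; rewrite -e //; rewrite e => /negP[].
  exact/W_P/P_S.
have twistW t : b^-1 * s * b^-1 = t -> t \in W -> inverts_power s /\ t = s.
  by move=> e tW; case: twist => [[inv e2]|]; [rewrite -e e2|rewrite e tW].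
(* Sixteen products: each is 1, or would put [b b] in [W], or is affected. The squares come from
   [(b^-1 s)^2 = (b^-1 s b^-1) s] and its inverse. *)
have EE e e' : e \in E -> e' \in E -> e * e' \in S -> affected s (e * e').
  move=> eE e'E; move eqt: (e * e') => t tS.
  have tVS := symS _ tS.
  have t1 : t <> 1 by move=> t1; rewrite -t1 tS in S1.
  move: eE e'E eqt; rewrite !inE.
  move=> /or4P[]/eqP -> /or4P[]/eqP ->; gsimp => eqt.
  - by case: (bbP _ eqt (P_S _ tS)).
  - by case: t1.
  - by rewrite -eqt; apply: Or31.
  - have [||inv ts] := @twistW t^-1; [by rewrite -eqt; gsimp|exact/W_P/P_S|].
    by apply: Or32; rewrite -ts invgK.
  - by case: t1.
  - case: (bbP t^-1); last exact: P_S.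
    by rewrite -eqt; gsimp.
  - case: (bbP (s * t^-1)); last exact: P_mul.
    by rewrite -eqt; gsimp.
  - apply: Or32; apply: invg_inj; rewrite invgK; apply: conjP => //.
    by rewrite -eqt; gsimp.
  - by apply/Or31/conjP.
  - by have [|_ ->] := twistW _ eqt; [exact/W_P/P_S|apply: Or31].
  - have [||inv ts] := @twistW (t * s^-1); [by rewrite -eqt; gsimp| |].
      by apply/W_P/P_mul.
    by apply: Or33; split=> //; left; rewrite -{1}ts; gsimp.
  - by case: t1.
  - case: (bbP (s * t)); last exact: P_mul.
    by rewrite -eqt; gsimp.
  - by apply: Or32.
  - by case: t1.
  - have [||inv ts] := @twistW (t^-1 * s^-1); [by rewrite -eqt; gsimp| |].
      by apply/W_P/P_mul.
    apply: Or33; split=> //; right; apply: invg_inj; rewrite invgK -{1}ts.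
    by gsimp.
have sE e : e \in E -> e \in E ++ S by rewrite mem_cat => ->.
have sS' e : e \in S -> e \in E ++ S by rewrite mem_cat => ->; rewrite orbT.
have E_mulS e x y : e \in E -> x \in S -> y \in S -> e != x * y.
  by move=> /E_P eP xS yS; apply: contra eP => /eqP ->; apply: P_mul.
exists (E ++ S); split=> //.
- by move=> x; rewrite !mem_cat => /orP[/symE|/symS] ->; rewrite ?orbT.
- rewrite mem_cat negb_or S1 andbT; apply/negP => /E_P.
  by rewrite P_1.
split.
- move=> e; rewrite mem_cat => /orP[eE _|->//]; split; last by move=> x y; apply: E_mulS.
  (* In a triangle on a new edge the other two labels are not both old, so [z] or [e^-1 z] is one of
     the four new labels. *)
  have -> : 8%N = size (E ++ [seq e * x | x <- E]) by [].
  apply: uniq_leq_size; first by rewrite filter_uniq ?undup_uniq.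
  move=> z; rewrite mem_filter mem_undup !mem_cat => /andP[].
  case/orP=> [ezE _|ezS].
    by apply/orP; right; apply/mapP; exists (e^-1 * z) => //; rewrite mulVKg.
  case/orP=> [->//|zS].
  have /eqP[] := E_mulS e z (e^-1 * z)^-1 eE zS (symS _ ezS); by gsimp.
- move=> t tS nat; apply: triangles_eq => // z.
  have old e : e \in E -> t^-1 * e \in S -> False.
    by move=> eE teS; have /eqP[] := E_mulS e t _ eE tS teS; rewrite mulVKg.
  rewrite !mem_cat => /orP[zE|zS] /orP[tzE|tzS] //; exfalso.
  + apply: nat; have -> : t = z * (t^-1 * z)^-1 by gsimp.
    by apply: EE; rewrite ?symE //; gsimp.
  + exact: old tzS.
  + have /eqP[] := E_mulS _ t^-1 z tzE (symS _ tS) zS; by [].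
- apply: (@triangles_lt _ _ _ b) => //.
  + by apply: sE; rewrite !inE eqxx.
  + by rewrite -(invgK (s^-1 * b)); apply/sE/symE; rewrite !inE; gsimp; rewrite eqxx !orbT.
  + by apply: E_S; rewrite !inE eqxx.
Qed.

End Triangles.

(** * Separating labels by their triangle counts *)

Section Colouring.
Local Open Scope group_scope.
Variables (G : groupType) (a : G).
Hypothesis a_inf : infinite_order a.
Implicit Types (S T P L W : seq G) (s t e b x y : G).

(** Iterate [add_triangle]. Labels created earlier keep a count of at most 8: a later round affects
    only [s], its square and their inverses, and no new label is of this form, not being a product
    of two labels of [S]. *)
Lemma add_triangles n S s : sym_closed S -> 1 \notin S -> s \in S ->
  exists S', [/\ {subset S <= S'}, sym_closed S', 1 \notin S' &
    [/\ forall e, e \in S' -> e \notin S ->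
          (triangles S' e <= 8)%N /\ (forall x y, x \in S -> y \in S -> e != x * y),
        forall t, t \in S -> ~ affected a s t -> triangles S' t = triangles S t &
        (n <= triangles S' s)%N]].
Proof.
move=> symS S1 sS; elim: n => [|n [S' [sub symS' S1' [new old ns]]]].
  by exists S; split=> //; split=> // e ->.
have [S2 [sub2 symS2 S12 [new2 old2 lt2]]] := add_triangle a_inf symS' S1' (sub _ sS).
exists S2; split=> //; first by move=> x /sub/sub2.
split; last exact: leq_ltn_trans lt2.
- move=> e eS2 eS; have [eS'|eS'] := boolP (e \in S'); last first.
    have [le8 neq] := new2 e eS2 eS'; split=> // x y xS yS.
    by apply: neq; apply: sub.
  have [le8 neq] := new e eS' eS; split=> //; rewrite old2 // => -[es|es|[_ es]].
  + by rewrite es sS in eS.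
  + by rewrite es symS in eS.
  + case: es => es; first by have := neq s s sS sS; rewrite es eqxx.
    by have := neq s^-1 s^-1 (symS _ sS) (symS _ sS); rewrite es invgM eqxx.
- by move=> t tS nt; rewrite old2 ?old //; apply: sub.
Qed.

(* [P] collects the labels already separated from all others; those outside [T]
   lie on few triangles. *)
Record separating T S P : Prop := Separating {
  sep_sub : {subset T <= S};
  sep_sym : sym_closed S;
  sep_one : 1 \notin S;
  sep_new : forall e, e \in S -> e \notin T ->
    (triangles S e <= 8)%N /\ (forall x y, x \in T -> y \in T -> e != x * y);
  sep_symP : sym_closed P;
  sep_subP : {subset P <= T};
  sep_big : forall p, p \in P -> (8 < triangles S p)%N;
  sep_inj : forall p q, p \in P -> q \in P -> triangles S p = triangles S q ->
    q = p \/ q = p^-1 }.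

(* The squares of the labels inverting a power of [a] do not invert any, so
   their triangle counts are not spoiled if the former are treated first. *)
Lemma separate L T S P : separating T S P -> sym_closed T ->
  (forall s, s \in L -> s \in T /\
     (inverts_power a s -> forall p, p \in P ++ L -> inverts_power a p)) ->
  exists S' P', [/\ separating T S' P', {subset L <= P'} & {subset P <= P'}].
Proof.
move=> sepP symT; elim: L S P sepP => [|s L IHL] S P sepP LP.
  by exists S, P; split.
have [sT sinv] := LP s (mem_head _ _).
have [sP|sP] := boolP (s \in P).
  have [t|S' [P' [sep' subL subP]]] := IHL S P sepP.
    move=> tL; have [|tT tinv] := LP t; first by rewrite inE tL orbT.
    split=> // /tinv inv p pPL; apply: inv; move: pPL.
    by rewrite !mem_cat inE => /orP[->|->]; rewrite ?orbT.
  exists S', P'; split=> // x; rewrite inE => /predU1P[->|/subL//].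
  exact: subP.
have [sub symS S1 new symP subP big inj] := sepP.
(* A count of at least [9 + B + 1] exceeds 8 and every count on [P]. *)
pose B := \sum_(p <- P) triangles S p.
have leB p : p \in P -> (triangles S p <= B)%N.
  by move=> pP; rewrite /B (big_rem p) //= leq_addr.
have [S' [subS symS' S1' [new' old' sbig]]] :=
  add_triangles (9 + B).+1 symS S1 (sub _ sT).
have [sS sVS] : s \in S /\ s^-1 \in S by split; [|apply: symS]; apply: sub.
have sVP : s^-1 \notin P by apply: contra sP => /symP; rewrite invgK.
have oldP p : p \in P -> triangles S' p = triangles S p.
  move=> pP; apply: old'; first exact/sub/subP.
  case=> [ps|ps|[sinv' ps]]; first by rewrite -ps pP in sP.
    by rewrite -ps pP in sVP.
  have : inverts_power a p by apply: sinv => //; rewrite mem_cat pP.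
  case: ps => ->; first exact: inverts_power_sqr.
  by rewrite invgM; apply: inverts_power_sqr => //; apply: inverts_powerV.
have sE r : r \in [:: s; s^-1] -> triangles S' r = triangles S' s.
  by rewrite !inE => /orP[]/eqP -> //; apply: trianglesV.
have neq r p : r \in [:: s; s^-1] -> p \in P -> triangles S' r <> triangles S' p.
  move=> /sE -> pP e; have := leB p pP; rewrite -oldP // -e => le.
  by have := leq_trans sbig le; rewrite ltnNge leq_addl.
have sep' : separating T S' ([:: s; s^-1] ++ P).
  split=> //.
  - by move=> t /sub/subS.
  - move=> e eS' eT; have [eS|eS] := boolP (e \in S); last first.
      have [le8 eneq] := new' e eS' eS; split=> // x y /sub xS /sub yS.
      exact: eneq.
    have [le8 eneq] := new e eS eT; split=> //; rewrite old' // => -[es|es|[_ es]].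
    + by rewrite es sT in eT.
    + by rewrite es symT in eT.
    + case: es => es; first by have := eneq s s sT sT; rewrite es eqxx.
      have := eneq s^-1 s^-1 (symT _ sT) (symT _ sT).
      by rewrite es invgM eqxx.
  - move=> p; rewrite !mem_cat !inE -orbA => /or3P[/eqP ->|/eqP ->|/symP ->].
    + by rewrite eqxx orbT.
    + by rewrite invgK eqxx.
    + by rewrite !orbT.
  - move=> p; rewrite mem_cat !inE -orbA => /or3P[/eqP ->|/eqP ->|/subP] //.
    exact: symT.
  - move=> p; rewrite mem_cat => /orP[/sE ->|pP]; last by rewrite oldP // big.
    by apply: leq_trans sbig; rewrite ltnS leq_addr.
  - move=> p q; rewrite !mem_cat => /orP[ps|pP] /orP[qs|qP].
    + move=> _; move: ps qs; rewrite !inE => /orP[]/eqP -> /orP[]/eqP ->;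
        rewrite ?invgK; by [left|right].
    + by move/(neq _ _ ps qP).
    + by move/esym/(neq _ _ qs pP).
    + by rewrite !oldP //; apply: inj.
have [t tL|S2 [P' [sep2 subL2 subP2]]] := IHL S' _ sep'.
  have [|tT tinv] := LP t; first by rewrite inE tL orbT.
  split=> // /tinv inv p; rewrite !mem_cat !inE => pPL.
  have [->|ps] := eqVneq p s.
    by apply: inv; rewrite mem_cat mem_head orbT.
  have [->|ps'] := eqVneq p s^-1.
    by apply: inverts_powerV; apply: inv; rewrite mem_cat mem_head orbT.
  apply: inv; rewrite mem_cat inE; move: pPL.
  by rewrite (negPf ps) (negPf ps').
exists S2, P'; split=> //.
- move=> x; rewrite inE => /predU1P[->|/subL2//].
  by apply: subP2; rewrite mem_head.
- by move=> x xP; apply: subP2; rewrite mem_cat xP orbT.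
Qed.

(** Two passes of [separate]: first the labels inverting a power of [a], then the others, for which
    its side condition is vacuous. A label outside [T] cannot share the count of one in [T], since 8
    lies between them. *)
Lemma triangle_colouring T : sym_closed T -> 1 \notin T ->
  exists S, [/\ {subset T <= S}, sym_closed S, 1 \notin S &
    forall t u, t \in T -> u \in S -> triangles S t = triangles S u ->
      u = t \/ u = t^-1].
Proof.
move=> symT T1; have sep0 : separating T T [::].
  by split=> // e eT; rewrite eT.
pose inv t := `[<inverts_power a t>].
have [t|S1 [P1 [sep1 L1 _]]] := separate (L := [seq t <- T | inv t]) sep0 symT.
  rewrite mem_filter => /andP[_ tT]; split=> // _ p.
  by rewrite mem_filter => /andP[/asboolP].
have [t|S [P [sep L2 P1P]]] := separate (L := [seq t <- T | ~~ inv t]) sep1 symT.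
  by rewrite mem_filter => /andP[/asboolPn].
have TP t : t \in T -> t \in P.
  move=> tT; have [it|it] := boolP (inv t).
    by apply/P1P/L1; rewrite mem_filter it.
  by apply: L2; rewrite mem_filter it.
exists S; split; [exact: sep_sub sep|exact: sep_sym sep|exact: sep_one sep|].
move=> t u /TP tP uS tu; apply: (sep_inj sep tP _ tu).
have [/TP//|uT] := boolP (u \in T).
by have := sep_big sep tP; rewrite tu ltnNge (sep_new sep uS uT).1.
Qed.

End Colouring.

(** * Rigidity *)

Section Rigidity.
Local Open Scope group_scope.
Variables (G : groupType) (a : G) (A : seq G).
Hypotheses (a_inf : infinite_order a) (symA : sym_closed A).
Hypotheses (A_1 : 1 \in A) (A_a : a \in A).

Lemma colour_preserving_id (sigma : G -> G) :
  (forall g1 g2 c1 c2 c3, g1 \in A -> g2 \in A -> c1 \in A -> c2 \in A -> c3 \in A ->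
     let g := g1 * g2 in let c := c1 * c2 * c3 in
     sigma (g * c) = sigma g * c \/ sigma (g * c) = sigma g * c^-1) ->
  {in A, forall s, sigma s = s} ->
  {in A &, forall s t, sigma (s * t) = s * t}.
Proof.
move=> col fixA.
have A_aV := symA A_a.
have a_sqr : a * a <> 1 by rewrite -expg2; apply/eqP/a_inf.
have col1 s c : s \in A -> c \in A ->
    sigma (s * c) = s * c \/ sigma (s * c) = s * c^-1.
  move=> sA cA; have := col _ _ _ _ _ sA A_1 cA A_1 A_1.
  by rewrite /= !mulg1 (fixA s).
have col0 c1 c2 c3 : c1 \in A -> c2 \in A -> c3 \in A ->
    sigma (c1 * c2 * c3) = c1 * c2 * c3 \/ sigma (c1 * c2 * c3) = (c1 * c2 * c3)^-1.
  move=> h1 h2 h3; have := col _ _ _ _ _ A_1 A_1 h1 h2 h3.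
  by rewrite /= !mulg1 !mul1g (fixA 1) // !mul1g.
(* Otherwise [s] and [a] satisfy the quaternion relations [a s a^-1 = s^-1] and [a^2 = s^2], whence
   [a^4 = 1]. *)
have fix_a s : s \in A -> sigma (s * a) = s * a.
  move=> sA; have [//|e1] := col1 _ _ sA A_a.
  have := col0 _ _ _ sA A_a A_1; rewrite mulg1 => -[//|e2].
  have r1 : a * s = s^-1 * a.
    by apply: (mulIg a^-1); apply: (mulgI a^-1); gsimp; rewrite -e1 e2; gsimp.
  have r2 : s * a = a * s^-1.
    by apply: (mulIg s); apply: (mulgI s^-1); gsimp; rewrite r1; gsimp.
  have := col1 _ _ A_a (symA sA); rewrite -r2 invgK => -[//|e3].
  have r3 : a * a = s * s.
    apply: (mulgI s^-1); apply: (mulIg a^-1); gsimp.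
    by rewrite -r1 -e3 e1; gsimp.
  exfalso; have /eqP[] := a_inf (isT : 0 < 4)%N.
  have r4 : a * (s * s) = (s * s)^-1 * a.
    by rewrite mulgA r1 -mulgA r1; gsimp.
  rewrite -r3 in r4; apply: (mulgI a^-1).
  by rewrite !expgS mulg1 [a * (a * a)]r4; gsimp.
move=> s t sA tA; apply: contrapT => st_neq.
have [sVA tVA] := (symA sA, symA tA).
have e1 : sigma (s * t) = s * t^-1 by case: (col1 _ _ sA tA).
have e2 : sigma (s * t) = t^-1 * s^-1.
  have := col0 _ _ _ sA tA A_1; rewrite mulg1 => -[//|->].
  by rewrite invgM.
have r1 : t * s^-1 = s * t.
  by apply: invg_inj; gsimp; rewrite -e2 e1.
have e3 : sigma (s * t) = t * s.
  by have := col1 _ _ tA sVA; rewrite r1 invgK => -[].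
(* Now use the edges to [s t] from the fixed points [s a], [t a] and [a], with labels [a^-1 t],
   [a^-1 s^-1] and [a^-1 s t]. If [s t] moves, then [t], [s] and [s t] all invert [a] by
   conjugation; but a product of two inverting elements centralizes [a], so [a^2 = 1]. *)
have r2 : a * t^-1 * a = t^-1.
  have := col _ _ _ _ _ sA A_a A_aV tA A_1.
  rewrite /= (fix_a s) //; gsimp => -[//|].
  by rewrite e1 -!mulgA => /mulgI/esym.
have r3 : a * s * a = s.
  have := col _ _ _ _ _ tA A_a A_aV sVA A_1.
  rewrite /= (fix_a t) //; gsimp; rewrite r1 => -[//|].
  by rewrite e3 -!mulgA => /mulgI/esym.
have r4 : a * (t^-1 * s^-1) * a = t^-1 * s^-1.
  have := col _ _ _ _ _ A_a A_1 A_aV sA tA.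
  rewrite /= mulg1 (fixA a) //; gsimp => -[//|].
  by rewrite e2; gsimp => /esym.
apply: a_sqr.
have r5 : a * t^-1 = t^-1 * a^-1 by rewrite -{2}r2; gsimp.
have r6 : s^-1 * a = a * s^-1.
  move: r4; rewrite mulgA r5 -!mulgA => /mulgI e.
  by apply: (mulgI a^-1); rewrite e; gsimp.
have r7 : s * a = a * s.
  by apply: (mulgI s^-1); apply: (mulIg s^-1); gsimp; rewrite r6.
by apply: (mulgI s); rewrite mulgA r7 r3 mulg1.
Qed.

End Rigidity.

(** * Rigidity of charts *)

Section RigidCharts.
Local Open Scope group_scope.
Variables (G : groupType) (S : seq G) (HS : sym_generating S).
Hypothesis S_1 : 1 \notin S.
Notation X := (cayley HS).

Lemma cayley_adjE (g h : G) : adj (g : X) (h : X) <-> g^-1 * h \in S.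
Proof.
split=> [/cayley_adjP[]//|ghS]; apply/cayley_adjP; split=> //.
by apply: contra S_1 => /eqP e; rewrite -{1}(mulVg h) -{1}e.
Qed.

Lemma adj_mulr (g s : G) : s \in S -> adj (g : X) (g * s : X).
Proof. by move=> sS; apply/cayley_adjE; rewrite mulKg. Qed.

(** The chart carries the triangles on the edge from [g] to [g c] bijectively to those on its image.
    Radius 2 suffices: the vertices [g c] and [g z] are within 2 of the centre, so the chart
    respects the edge joining them. *)
Lemma chart_triangles (sigma : X -> X) g c : chart (1 : X) 2 sigma ->
  reach 1 (1 : X) g -> c \in S ->
  triangles S ((sigma g)^-1 * sigma (g * c)) = triangles S c.
Proof.
move=> sigmaP g1 cS; set c' := _^-1 * _.
have g2 : reach 2 (1 : X) g by left.
have near s : s \in S -> reach 2 (1 : X) (g * s).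
  by move=> sS; apply: reach_adj g1 (adj_mulr _ sS).
have near3 s : s \in S -> reach 3 (1 : X) (g * s) by move=> /near; left.
have tri z : c'^-1 * ((sigma g)^-1 * sigma (g * z)) = (sigma (g * c))^-1 * sigma (g * z).
  by rewrite /c'; gsimp.
have cz z : (g * c)^-1 * (g * z) = c^-1 * z by gsimp.
pose f z := (sigma g)^-1 * sigma (g * z).
apply/eqP; rewrite eqn_leq; apply/andP; split.
  rewrite {2}/triangles -(size_map f).
  apply: uniq_leq_size; first by rewrite filter_uniq ?undup_uniq.
  move=> z'; rewrite mem_filter mem_undup => /andP[cz' z'S].
  have gz' : adj (sigma g) (sigma g * z' : X) by apply: adj_mulr.
  have [h h3 hE] := chart_surj sigmaP g2 gz'.
  have gh : adj (g : X) h by apply/(chart_adj sigmaP) => //; rewrite hE.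
  apply/mapP; exists (g^-1 * h); last by rewrite /f mulVKg hE mulKg.
  rewrite mem_filter mem_undup; apply/andP; split; last exact/cayley_adjE.
  have -> : c^-1 * (g^-1 * h) = (g * c)^-1 * h by gsimp.
  apply/cayley_adjE/(chart_adj sigmaP (near _ cS) h3)/cayley_adjE.
  by rewrite hE; move: cz'; rewrite /c'; gsimp.
rewrite {1}/triangles -(size_map f).
have f_inj : {in [seq z <- undup S | c^-1 * z \in S] &, injective f}.
  move=> z1 z2; rewrite !mem_filter !mem_undup => /andP[_ z1S] /andP[_ z2S].
  move=> /mulgI /(chart_inj sigmaP (near3 _ z1S) (near3 _ z2S)).
  exact: mulgI.
apply: uniq_leq_size; first by rewrite (map_inj_in_uniq f_inj) filter_uniq ?undup_uniq.
move=> _ /mapP[z + ->]; rewrite !mem_filter !mem_undup => /andP[czS zS].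
apply/andP; split.
  rewrite tri; apply/cayley_adjE/(chart_adj sigmaP (near _ cS) (near3 _ zS)).
  by apply/cayley_adjE; rewrite cz.
by apply/cayley_adjE/(chart_adj sigmaP g2 (near3 _ zS))/adj_mulr.
Qed.

Variables (a : G) (A : seq G).
Hypotheses (a_inf : infinite_order a) (symA : sym_closed A).
Hypotheses (A_1 : 1 \in A) (A_a : a \in A).
Hypothesis A_S : forall x y z, x \in A -> y \in A -> z \in A ->
  x * y * z != 1 -> x * y * z \in S /\
  forall u, u \in S -> triangles S (x * y * z) = triangles S u ->
    u = x * y * z \/ u = (x * y * z)^-1.

Lemma reach_A2 x y : x \in A -> y \in A -> reach 1 (1 : X) (x * y).
Proof.
move=> xA yA; apply/reach1; have [->|xy1] := eqVneq (x * y) 1; first by left.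
right; apply/cayley_adjE; rewrite invg1 mul1g -[_ * y]mulg1.
by apply: (A_S xA yA A_1 _).1; rewrite mulg1.
Qed.

Lemma reach_A x : x \in A -> reach 1 (1 : X) x.
Proof. by move=> xA; rewrite -(mulg1 x); apply: reach_A2. Qed.

Lemma chart_rigid (sigma : X -> X) : chart (1 : X) 2 sigma ->
  {in A, forall s, sigma s = s} -> {in A &, forall s t, sigma (s * t) = s * t}.
Proof.
move=> sigmaP; apply: (colour_preserving_id a_inf symA A_1 A_a).
move=> g1 g2 c1 c2 c3 g1A g2A c1A c2A c3A g c.
have [->|cn1] := eqVneq c 1; first by rewrite !mulg1; left.
have [cS sep] := A_S c1A c2A c3A cn1.
have gr : reach 1 (1 : X) g by apply: reach_A2.
have gr2 : reach 2 (1 : X) g by left.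
have gc : adj (g : X) (g * c : X) by apply: adj_mulr.
have gcr : reach 3 (1 : X) (g * c) by left; apply: reach_adj gr gc.
have := chart_triangles sigmaP gr cS.
have sS : (sigma g)^-1 * sigma (g * c) \in S.
  by apply/cayley_adjE/(chart_adj sigmaP gr2 gcr).
move=> /esym /(sep _ sS) [] e; [left|right].
  by rewrite -[c in RHS]e mulVKg.
by rewrite -[c^-1]e mulVKg.
Qed.

(** Apply [chart_rigid] to the inverse of [psi] after [phi]. Consequently the restriction of
    [phi (g _)] to [A], for [g] in [A], depends only on that of [phi]. *)
Lemma chart_determined (Y : graph) (phi psi : X -> Y) :
  chart (1 : X) 2 phi -> chart (1 : X) 2 psi ->
  {in A, phi =1 psi} -> {in A &, forall s t, phi (s * t) = psi (s * t)}.
Proof.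
move=> phiP psiP agree s t sA tA.
have [theta thetaP thetaK] := chart_inverse psiP.
have r3 g : reach 1 (1 : X) g -> reach 3 (1 : X) g by apply: reach_le.
have := chart_comp phiP; rewrite (agree 1 A_1) => /(_ _ _ thetaP)/chart_rigid.
move=> /(_ _ s t sA tA) /= e.
have st3 := r3 _ (reach_A2 sA tA).
have := chart_reach phiP (leqnn _) st3; rewrite (agree 1 A_1).
move=> /(chart_reach_surj psiP (leqnn _))[h h3 hE].
have {}e : theta (phi (s * t)) = s * t.
  by apply: e => // u uA; rewrite /= agree // thetaK //; apply/r3/reach_A.
by rewrite -hE -e -hE thetaK.
Qed.

End RigidCharts.

(** * Frames *)

(** Each [f] satisfies all [P m] or fails at some [k f]; the maximum of the [k f] works. *)
Lemma antitone_stable (T : finType) (P : nat -> T -> Prop) :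
  (forall m n f, (m <= n)%N -> P n f -> P m f) ->
  exists m0, forall m f, P m0 f -> P m f.
Proof.
move=> P_le; have /choice[k kP] f : exists k, P k f -> forall m, P m f.
  have [Pf|/existsNP[k nP]] := pselect (forall m, P m f); first by exists 0.
  by exists k.
exists (\max_f k f) => m f Pf; apply: kP; apply: P_le Pf.
exact: leq_bigmax.
Qed.

Lemma finite_set_ord (T : Type) : finite_set [set: T] ->
  exists k (e : T -> 'I_k), injective e.
Proof.
move=> /finite_setP[k /card_set_bijP[f [fin finj _]]].
have flt t : (f t < k)%N by apply: (fin t).
exists k, (fun t => Ordinal (flt t)) => t t' /(congr1 val) /= ftt'.
by apply: finj; rewrite ?in_setT.
Qed.

Lemma eval_word_cat (H : groupType) r (y : 'I_r -> H) (u v : word r) :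
  (eval_word y (u ++ v) = eval_word y u * eval_word y v)%g.
Proof. by rewrite /eval_word big_cat. Qed.

Lemma eval_word_pres_eq (H : groupType) r (y : 'I_r -> H) (rels : seq (word r)) :
  (forall w, w \in rels -> eval_word y w = 1%g) ->
  forall w1 w2, pres_eq rels w1 w2 -> eval_word y w1 = eval_word y w2.
Proof.
move=> rel1 w1 w2; elim=> {w1 w2} // [w1 w2 w3 _ -> _ ->//|u i b v|u w v wr].
  rewrite !eval_word_cat /eval_word !big_cons /eval_letter /=.
  by case: b; rewrite /= ?mulKg ?mulVKg.
by rewrite !eval_word_cat (rel1 w) // mul1g.
Qed.

Section Frames.
Local Open Scope group_scope.
Variables (G : groupType) (S : seq G) (HS : sym_generating S) (S_1 : 1 \notin S).
Notation X := (cayley HS).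
Variables (a : G) (A : seq G).
Hypotheses (a_inf : infinite_order a) (symA : sym_closed A).
Hypotheses (A_1 : 1 \in A) (A_a : a \in A).
Hypothesis A_S : forall x y z, x \in A -> y \in A -> z \in A ->
  x * y * z != 1 -> x * y * z \in S /\
  forall u, u \in S -> triangles S (x * y * z) = triangles S u ->
    u = x * y * z \/ u = (x * y * z)^-1.

Let A_near x : x \in A -> reach 1 (1 : X) x.
Proof. exact: (reach_A HS S_1 A_1 A_S). Qed.

(** Charts of [X] fixing 1 have finitely many restrictions to [A], and these restrictions can only
    get fewer as the radius grows. So from some radius on, each one comes from charts of every
    radius, which may depend on the radius. *)
Lemma stable_radius : exists2 m0, (2 <= m0)%N &
  forall sigma : X -> X, chart (1 : X) m0 sigma -> sigma 1 = 1 ->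
  forall m, exists2 sigma' : X -> X, chart (1 : X) m sigma' & {in A, sigma' =1 sigma}.
Proof.
pose P m (f : {ffun seq_sub A -> seq_sub (1 :: S)}) := exists2 sigma : X -> X,
  chart (1 : X) m sigma & forall s, sigma (val s) = val (f s).
have [m n f mn [sigma sP sf]|m0 stab] := @antitone_stable _ P.
  by exists sigma => //; apply: chart_le mn.
exists (maxn 2 m0) => [|sigma sP s1 m]; first by rewrite leq_maxl.
(* The default of [insubd] is never taken: [sigma] fixes 1 and preserves adjacency, so it maps [A]
   into [1 :: S]. *)
pose f := [ffun s : seq_sub A => insubd (SeqSub (mem_head 1 S)) (sigma (val s))].
have fE s : val (f s) = sigma (val s).
  rewrite ffunE insubdK // inE.
  have := chart_reach sP _ (A_near (valP s)); rewrite s1 => /(_ isT)/reach1.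
  case=> [<-|/(cayley_adjE HS S_1)]; first by rewrite eqxx.
  by rewrite invg1 mul1g orbC => ->.
have [|sigma' sP' s'E] := stab m f.
  by exists sigma => [|s]; [apply: chart_le sP _ _; rewrite leq_maxr|rewrite fE].
by exists sigma' => // s sA; rewrite (s'E (SeqSub sA)) fE.
Qed.

Variables (m0 n : nat) (Y : graph) (k : nat) (enc : Y -> 'I_k).
Hypothesis m0_ge2 : (2 <= m0)%N.
Hypothesis stable : forall sigma : X -> X, chart (1 : X) m0 sigma -> sigma 1 = 1 ->
  forall m, exists2 sigma' : X -> X, chart (1 : X) m sigma' & {in A, sigma' =1 sigma}.
Hypothesis enc_inj : injective enc.
Hypothesis m0_lt_n : (m0 < n)%N.
Hypothesis Y_chart : forall y : Y, exists2 phi : X -> Y, phi 1 = y & chart (1 : X) n phi.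

(** Compare [phi] with a chart [psi] of radius [n] at the same centre: the transition map is a chart
    of [X] fixing 1, and [stable] replaces it by one of radius [n]. This restores the radius lost
    when a generator acts. *)
Lemma chart_extend (phi : X -> Y) : chart (1 : X) m0 phi ->
  exists2 phi' : X -> Y, chart (1 : X) n phi' & {in A, phi' =1 phi}.
Proof.
move=> phiP; have [psi psi1 psiP] := Y_chart (phi 1).
have psiP0 := chart_le psiP (ltnW m0_lt_n).
have [theta thetaP thetaK] := chart_inverse psiP0.
rewrite psi1 in thetaP.
have theta1 : theta (phi 1) = 1 by rewrite -psi1 thetaK //; exact: reach_refl.
have [sigma sP sE] := stable (chart_comp phiP thetaP) theta1 n.
have sigma1 : sigma 1 = 1 by rewrite sE.
exists (psi \o sigma); first by apply: chart_comp sP _; rewrite sigma1.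
move=> s sA; rewrite /= sE //=.
have sr : reach m0.+1 (1 : X) s by apply: reach_le (A_near sA).
have := chart_reach phiP (leqnn _) sr; rewrite -psi1.
by move=> /(chart_reach_surj psiP0 (leqnn _))[h hr <-]; rewrite thetaK.
Qed.

(** Vertices are encoded in ['I_k] so that frames live in a finite type, whose permutations form a
    finite group. *)
Definition frame (phi : X -> Y) : {ffun seq_sub A -> 'I_k} :=
  [ffun s => enc (phi (val s))].

Definition is_frame f := exists2 phi : X -> Y, chart (1 : X) m0 phi & f = frame phi.

Lemma frame_eq (phi psi : X -> Y) : frame phi = frame psi <-> {in A, phi =1 psi}.
Proof.
split=> [/ffunP e s sA|e].
  by apply: enc_inj; have := e (SeqSub sA); rewrite !ffunE.
by apply/ffunP => s; rewrite !ffunE e // (valP s).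
Qed.

Lemma chart_shift m m' j g (phi : X -> Y) : chart (1 : X) m phi ->
  reach j (1 : X) g -> (j + m' <= m)%N -> chart (1 : X) m' (phi \o mul g : X -> Y).
Proof.
move=> phiP gj jm; apply: chart_comp (chart_mul _ _ _ _) _.
by rewrite mulg1; apply: chart_recenter gj jm.
Qed.

Lemma frame_lift : exists ext : {ffun seq_sub A -> 'I_k} -> X -> Y,
  forall f, is_frame f -> chart (1 : X) n (ext f) /\ f = frame (ext f).
Proof.
have /choice[ext extP] f : exists phi : X -> Y, is_frame f ->
    chart (1 : X) n phi /\ f = frame phi.
  have [[phi /chart_extend[phi' phiP' e] ->]|nf] := pselect (is_frame f).
    by exists phi' => _; split=> //; apply/frame_eq => s sA; rewrite e.
  have [y] := vert_inhabited Y.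
  by exists (fun=> y).
by exists ext.
Qed.

Variable ext : {ffun seq_sub A -> 'I_k} -> X -> Y.
Hypothesis extP : forall f, is_frame f -> chart (1 : X) n (ext f) /\ f = frame (ext f).

(** Trivial off the frames and for [g] outside [A], so that every [g] permutes the whole finite
    type. *)
Definition act g (f : {ffun seq_sub A -> 'I_k}) :=
  if `[<is_frame f>] && (g \in A) then frame (ext f \o mul g) else f.

Lemma is_frame_chart m (phi : X -> Y) : (m0 <= m)%N -> chart (1 : X) m phi ->
  is_frame (frame phi).
Proof. by move=> mm phiP; exists phi => //; apply: chart_le mm. Qed.

(** The action does not depend on the chosen lift [ext f]: by [chart_determined], lifts agreeing on
    [A] agree at the points [g s]. *)
Lemma act_frame m (phi : X -> Y) g : (m0 <= m)%N -> g \in A ->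
  chart (1 : X) m phi -> act g (frame phi) = frame (phi \o mul g).
Proof.
move=> mm gA phiP; have ff := is_frame_chart mm phiP.
rewrite /act gA andbT asboolT //; have [eP /frame_eq e] := extP ff.
apply/frame_eq => s sA /=; apply/esym.
have phiP2 := chart_le phiP (leq_trans m0_ge2 mm).
have eP2 := chart_le eP (leq_trans m0_ge2 (ltnW m0_lt_n)).
exact: (chart_determined S_1 a_inf symA A_1 A_a A_S phiP2 eP2 e).
Qed.

Lemma act_nonframe g f : ~ is_frame f -> act g f = f.
Proof. by move=> nf; rewrite /act asboolF. Qed.

Lemma actK g : cancel (act g) (act g^-1).
Proof.
move=> f; have [gA|gA] := boolP (g \in A); last first.
  have gVA : g^-1 \notin A by apply: contra gA => /symA; rewrite invgK.
  by rewrite /act (negPf gA) (negPf gVA) !andbF.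
have [ff|nf] := pselect (is_frame f); last by rewrite !act_nonframe.
have [eP fE] := extP ff; rewrite fE (act_frame (ltnW m0_lt_n) gA eP).
(* Shifting by [g] costs one unit of radius, available because [m0 < n]. *)
rewrite (act_frame (leqnn m0) (symA gA)); last first.
  exact: (chart_shift eP (A_near gA)).
by apply/frame_eq => s _ /=; rewrite mulVKg.
Qed.

Definition act_perm g : {perm {ffun seq_sub A -> 'I_k}} := perm (can_inj (actK g)).

Lemma act_permE g f : act_perm g f = act g f.
Proof. exact: permE. Qed.

Lemma act_permV g : act_perm g^-1 = (act_perm g)^-1.
Proof.
apply: (mulgI (act_perm g)); rewrite mulgV; apply/permP => f.
by rewrite permM !act_permE actK perm1.
Qed.

Variables (r : nat) (x : 'I_r -> G).
Hypothesis x_A : forall i, x i \in A.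
Notation y := (act_perm \o x).

Lemma eval_letter_act l : eval_letter y l = act_perm (eval_letter x l).
Proof. by case: l => i []; rewrite /eval_letter //= act_permV. Qed.

Lemma eval_letter_in l : eval_letter x l \in A.
Proof. by case: l => i []; rewrite /eval_letter /=; [apply: symA|]; apply: x_A. Qed.

(** Each letter costs one unit of radius. Permutations compose from left to right, as do the
    successive precompositions with left translations, so the letters multiply in the order of
    [w]. *)
Lemma eval_word_frame m (phi : X -> Y) (w : word r) : chart (1 : X) m phi ->
  (m0 + size w <= m)%N ->
  eval_word y w (frame phi) = frame (phi \o mul (eval_word x w)).
Proof.
elim: w m phi => [|l w IHw] m phi phiP /= mw.
  by rewrite /eval_word !big_nil perm1; apply/frame_eq => s _ /=; rewrite mul1g.
rewrite /eval_word !big_cons permM eval_letter_act act_permE.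
have lA := eval_letter_in l.
rewrite (act_frame _ lA phiP); last by apply: leq_trans mw; rewrite leq_addr.
rewrite [LHS](IHw (m0 + size w)%N) //; last first.
  by apply: (chart_shift phiP (A_near lA)); rewrite add1n -addnS.
by apply/frame_eq => s _ /=; rewrite mulgA.
Qed.

Lemma eval_word_nonframe (w : word r) f : ~ is_frame f -> eval_word y w f = f.
Proof.
move=> nf; rewrite /eval_word; elim: w => [|l w IHw].
  by rewrite big_nil perm1.
by rewrite big_cons permM eval_letter_act act_permE act_nonframe.
Qed.

(** Every frame lifts to a chart of radius [n], inside which the whole relator can be followed. *)
Lemma eval_word_relator (w : word r) : eval_word x w = 1 ->
  (m0 + size w <= n)%N -> eval_word y w = 1.
Proof.
move=> xw wn; apply/permP => f; rewrite perm1.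
have [ff|nf] := pselect (is_frame f); last exact: eval_word_nonframe.
have [eP fE] := extP ff; rewrite fE (eval_word_frame eP) // xw.
by apply/frame_eq => s _ /=; rewrite mul1g.
Qed.

(** If the frame of a chart [phi] were fixed, evaluation at 1 would give [phi] the same value at 1
    and at the element spelled by [w], against injectivity. *)
Lemma eval_word_nontrivial (w : word r) : eval_word x w != 1 ->
  (m0 + size w <= n)%N -> eval_word y w != 1.
Proof.
move=> xw wn; apply/eqP => yw; have [y0] := vert_inhabited Y.
have [phi _ phiP] := Y_chart y0.
have := eval_word_frame phiP wn; rewrite yw perm1 => /frame_eq/(_ 1 A_1) /=.
rewrite mulg1 => e; case/eqP: xw; apply/esym.
apply: (chart_inj phiP) e; first exact: reach_refl.
rewrite /eval_word; suff : reach (size w) (1 : X) (\prod_(l <- w) eval_letter x l).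
  by apply: reach_le; apply: leq_trans (leqnSn n); apply: leq_trans wn; rewrite leq_addl.
elim: w {wn yw} => [|l w IHw]; first by rewrite big_nil.
rewrite big_cons -[(size _)]add1n /=; set g := eval_letter x l.
apply: reach_trans (A_near (eval_letter_in l)) _.
by have := reach_mul g IHw; rewrite mulg1.
Qed.

End Frames.

(** Von Dyck's theorem; [pres] makes the value independent of the word chosen for an element. *)
Lemma presentation_morphism (G H : groupType) r (x : 'I_r -> G) (y : 'I_r -> H)
    (rels : seq (word r)) :
  (forall g, exists w, eval_word x w = g) ->
  (forall w1 w2, eval_word x w1 = eval_word x w2 <-> pres_eq rels w1 w2) ->
  (forall w, w \in rels -> eval_word y w = 1%g) ->
  exists phi : {multiplicative G -> H}, forall w, phi (eval_word x w) = eval_word y w.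
Proof.
move=> /choice[wd wdP] pres rel1.
have yE w1 w2 : eval_word x w1 = eval_word x w2 -> eval_word y w1 = eval_word y w2.
  by move=> /pres; apply: eval_word_pres_eq.
pose f g := eval_word y (wd g).
have fM : {morph f : g h / (g * h)%g}.
  by move=> g h; rewrite /f -eval_word_cat; apply: yE; rewrite eval_word_cat !wdP.
pose phi : {multiplicative G -> H} := HB.pack f (isMultiplicative.Build G H f fM).
by exists phi => w; apply: yE; rewrite wdP.
Qed.

(** * Choice of the generating sets *)

Section Generators.
Local Open Scope group_scope.
Variables (G : groupType) (a : G) (r : nat) (x : 'I_r -> G).
Hypothesis a_inf : infinite_order a.
Hypothesis x_gen : forall g, exists w, eval_word x w = g.

Lemma rigid_generators : exists (A S : seq G),
  [/\ [/\ sym_closed A, 1 \in A, a \in A & forall i, x i \in A],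
      sym_generating S, 1 \notin S,
      exists s1 s2 s3, [/\ s1 \in S, s2 \in S, s3 \in S,
        uniq [:: s1; s2; s3] & 1 \notin [:: s1; s2; s3]] &
      forall u v w, u \in A -> v \in A -> w \in A -> u * v * w != 1 ->
        u * v * w \in S /\
        forall t, t \in S -> triangles S (u * v * w) = triangles S t ->
          t = u * v * w \/ t = (u * v * w)^-1].
Proof.
have [A [symA A_1 A_a x_A]] : exists A : seq G,
    [/\ sym_closed A, 1 \in A, a \in A & forall i, x i \in A].
  have [L [L_a L_x]] : exists L : seq G, a \in L /\ forall i, x i \in L.
    exists (a :: [seq x i | i <- enum 'I_r]); split=> [|i]; first exact: mem_head.
    by rewrite inE map_f ?orbT // mem_enum.
  exists (1 :: L ++ [seq g^-1 | g <- L]); split=> [g|||i].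
  - rewrite !inE !mem_cat => /predU1P[->|/orP[gL|/mapP[h hL ->]]].
    + by rewrite invg1 eqxx.
    + by rewrite map_f ?orbT.
    + by rewrite invgK hL orbT.
  - exact: mem_head.
  - by rewrite inE mem_cat L_a orbT.
  - by rewrite inE mem_cat L_x orbT.
(* Three factors, because the rigidity argument follows edges labelled [c1 c2 c3]. *)
pose T := [seq g <- [seq p * w | p <- [seq u * v | u <- A, v <- A], w <- A] | g != 1].
have T_A u v w : u \in A -> v \in A -> w \in A -> u * v * w != 1 -> u * v * w \in T.
  move=> uA vA wA n1; rewrite mem_filter n1 andTb.
  have uvA : u * v \in [seq u * v | u <- A, v <- A] by apply: allpairs_f.
  exact: allpairs_f.
have symT : sym_closed T.
  move=> g; rewrite mem_filter => /andP[g1 /allpairsP[[p w] /= [+ wA gE]]].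
  move=> /allpairsP[[u v] /= [uA vA pE]]; rewrite pE in gE.
  have gVE : g^-1 = w^-1 * v^-1 * u^-1 by rewrite gE !invgM mulgA.
  by rewrite gVE; apply: T_A; rewrite ?symA // -gVE invg_eq1.
have T_1 : 1 \notin T by rewrite mem_filter eqxx.
have [S [TS symS S_1 sep]] := triangle_colouring a_inf symT T_1.
have S_A u : u \in A -> u != 1 -> u \in S.
  by move=> uA u1; apply: TS; rewrite -(mulg1 u) -(mulg1 (u * 1)) T_A // !mulg1.
have a_exp n : (0 < n)%N -> a ^+ n <> 1 by move=> /a_inf/eqP.
exists A, S; split=> //.
- split=> // g; have [w <-] := x_gen g.
  exists [seq s <- [seq eval_letter x l | l <- w] | s != 1]; split.
    move=> s; rewrite mem_filter => /andP[s1 /mapP[l _ sE]]; apply: S_A => //.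
    by rewrite sE; case: l {sE} => i []; rewrite /eval_letter /= ?symA.
  rewrite /eval_word; elim: w => [|l w IHw]; first by rewrite !big_nil.
  rewrite big_cons IHw /=; case: eqP => [->|_] /=; first by rewrite mul1g.
  by rewrite big_cons.
- have a1 : a != 1 by apply/eqP; rewrite -(expg1 a); apply: a_exp.
  have a2 : a * a != 1 by apply/eqP; rewrite -expg2; apply: a_exp.
  have a3 : a * a * a != 1.
    by apply/eqP => e; apply: (@a_exp 3) => //; rewrite !expgS mulg1 mulgA.
  (* Distinct and nontrivial because [a], [a^2] and [a^3] are not 1. *)
  exists a, a^-1, (a * a); split.
  + exact: S_A.
  + by apply: S_A; rewrite ?symA ?invg_eq1.
  + by apply: TS; rewrite -(mulg1 (a * a)) T_A // mulg1.
  + rewrite /= !inE !negb_or andbT -!andbA; apply/and3P; split.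
    * by rewrite -mulg_eq1.
    * by rewrite -{1}(mulg1 a) (inj_eq (mulgI a)) eq_sym.
    * by rewrite eq_sym -mulg_eq1.
  + by rewrite !inE !(eq_sym 1) !negb_or invg_eq1 a1 a2.
- move=> u v w uA vA wA n1; have uvwT := T_A _ _ _ uA vA wA n1.
  by split=> [|t tS]; [exact: TS|exact: sep].
Qed.

End Generators.

Theorem corollary11 (R : realType) (G : groupType) :
  finitely_presented G ->
  (exists g : G, infinite_order g) ->
  (forall (S : seq G) (HS : sym_generating S),
     exists Y : nat -> graph,
       (forall n, finite_graph (Y n)) /\
       (forall n, (0 < n)%N -> is_locally (n%:R : R) (cayley HS) (Y n))) ->
  residually_finite G.
Proof.
move=> [r [x [rels [x_gen pres]]]] [a a_inf] local g g1.
have [A [S [[symA A_1 A_a x_A] HS S_1 S3 A_S]]] := rigid_generators a_inf x_gen.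
have [m0 m0_ge2 stable] := stable_radius HS S_1 A_1 A_S.
have [w gE] := x_gen g.
(* Room beyond [m0] for the word of [g] and for each relator; the successor ensures [m0 < n] even if
   all these words are empty. *)
pose n := (m0 + \max_(u <- w :: rels) size u).+1.
have le_n u : u \in w :: rels -> (m0 + size u <= n)%N.
  by move=> uw; rewrite ltnW // ltnS leq_add2l; apply: leq_bigmax_seq.
have [Y [Y_fin Y_loc]] := local S HS.
(* The graph of index [n + 1] is used because isometries of balls of radius [n + 1] yield charts of
   radius [n]. *)
have [k [enc enc_inj]] := finite_set_ord (Y_fin n.+1).
have Y_chart := cayley_chart S3 (Y_loc n.+1 isT).
have m0_lt_n : (m0 < n)%N by rewrite ltnS leq_addr.
have [ext extP] := frame_lift S_1 A_1 A_S stable enc_inj m0_lt_n Y_chart.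
have [|phi phiE] := presentation_morphism x_gen pres
    (y := act_perm S_1 a_inf symA A_1 A_a A_S m0_ge2 enc_inj m0_lt_n extP \o x).
  move=> u ur; apply: eval_word_relator => //; last first.
    by apply: le_n; rewrite inE ur orbT.
  have <- : eval_word x [::] = 1%g by rewrite /eval_word big_nil.
  by apply/pres; have := pres_rel [::] [::] ur; rewrite cats0.
exists _, phi; rewrite -gE phiE.
apply: eval_word_nontrivial => //; first by rewrite gE.
by apply: le_n; rewrite mem_head.
Qed.
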